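(* There exists a network $\Gamma_{\min}$, which is a Theta--network or a ''degenerate'' Theta--network, that minimizes the functional $\overline{F}$ among all $3$--networks of class $H^2$.
   Context: Curves are parametrized on $[0,1]$ with constant speed equal to their length $L(\gamma)$; a curve of length zero is constant. A curve is regular if $|\partial_x\gamma|\ne0$ on $[0,1]$; then $\tau=\partial_x\gamma/|\partial_x\gamma|$ is its unit tangent. A $3$--network of class $H^2$ is a union of three curves $\gamma^1,\gamma^2,\gamma^3:[0,1]\to\mathbb{R}^2$ of class $H^2$ meeting at two triple junctions: $\gamma^1(0)=\gamma^2(0)=\gamma^3(0)$ and $\gamma^1(1)=\gamma^2(1)=\gamma^3(1)$. Lengths are allowed to be zero (no regularity is required). A Theta--network is a $3$--network of class $H^2$ whose three curves are regular and form angles of $120$ degrees at both junctions: $\sum_{i=1}^3\tau^i(0)=0$ and $\sum_{i=1}^3\tau^i(1)=0$. The curves may intersect and self-intersect. A ''degenerate'' Theta--network is a $3$--network consisting of two regular curves $\gamma^1,\gamma^2$ of class $H^2$, forming angles in pairs of $120$ and $60$ degrees, and of a curve $\gamma^3$ of length zero. Explicitly (up to relabeling the curves): $\gamma^3$ is constant equal to $P$, $\gamma^1(0)=\gamma^1(1)=\gamma^2(0)=\gamma^2(1)=P$, and, with the orientations inherited from the network, the vectors $\tau^1(0),\tau^2(0)$ form an angle of $120$ degrees and $\{\tau^1(0),\tau^2(0)\}=\{\tau^1(1),\tau^2(1)\}$. The functional $\overline{F}$ on $3$--networks of class $H^2$ is: $\overline{F}(\Gamma)=\sum_{i=1}^3\Big(\frac{1}{L^3(\gamma^i)}\int_0^1|\gamma^i_{xx}|^2\,\mathrm{d}x+L(\gamma^i)\Big)$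 if $\Gamma$ is a Theta--network; $\overline{F}(\Gamma)=\sum_{i=1}^2\Big(\frac{1}{L^3(\gamma^i)}\int_0^1|\gamma^i_{xx}|^2\,\mathrm{d}x+L(\gamma^i)\Big)$ (sum over the two curves of positive length) if $\Gamma$ is a ''degenerate'' Theta--network; $\overline{F}(\Gamma)=+\infty$ otherwise. *)

(* Defs.v *)
From mathcomp Require Import all_boot all_order all_algebra all_fingroup.
From mathcomp Require Import all_classical all_reals all_analysis.
Import Order.TTheory GRing.Theory Num.Theory.
Import numFieldNormedType.Exports.

Set Implicit Arguments.
Unset Strict Implicit.
Unset Printing Implicit Defensive.

Local Open Scope classical_set_scope.
Local Open Scope ring_scope.

(* The library norm on 'rV[R]_2 is the sup norm, hence the Euclidean structure
   below; the induced topology is the same. *)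
Definition dot (R : realType) (u v : 'rV[R]_2) : R := \sum_(i < 2) u 0 i * v 0 i.

Definition enorm (R : realType) (u : 'rV[R]_2) : R := Num.sqrt (dot u u).

Definition angle (R : realType) (u v : 'rV[R]_2) : R :=
  acos (dot u v / (enorm u * enorm v)).

(* C^1_c(]0, 1[), extended by zero to the real line. *)
Definition test_function (R : realType) (phi : R -> R) : Prop :=
  [/\ forall x : R, derivable phi x 1,
      continuous (derive1 phi) &
      closure [set x | phi x != 0] `<=` `]0, 1[].

(* Curves [0, 1] -> R^2 are total functions R -> 'rV[R]_2 of which only the
   values on [0, 1] are relevant. *)
Definition L2 (R : realType) (u : R -> 'rV[R]_2) : Prop :=
  forall j : 'I_2,
    (fun x : R => u x 0 j) \_ `]0, 1[ \in Lfun (@lebesgue_measure R) 2%:E.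

Definition weak_derivative (R : realType) (u v : R -> 'rV[R]_2) : Prop :=
  forall (phi : R -> R), test_function phi -> forall j : 'I_2,
    \int[@lebesgue_measure R]_(x in `]0, 1[) (u x 0 j * derive1 phi x) =
    - \int[@lebesgue_measure R]_(x in `]0, 1[) (v x 0 j * phi x).

Definition weak_second_derivative (R : realType) (u w : R -> 'rV[R]_2) : Prop :=
  exists v, [/\ L2 v, L2 w, weak_derivative u v & weak_derivative v w].

(* An element of the Sobolev space H^2(0, 1) is identified with its
   representative that is continuous on [0, 1]. *)
Definition class_H2 (R : realType) (g : R -> 'rV[R]_2) : Prop :=
  [/\ {within `[0, 1], continuous g}, L2 g &
      exists w, weak_second_derivative g w].

(* Pointwise derivative on [0, 1], one-sided at the endpoints; for curves of
   class H^2 the limit exists everywhere because H^2 embeds into C^1. *)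
Definition curve_x (R : realType) (g : R -> 'rV[R]_2) (x : R) : 'rV[R]_2 :=
  lim ((y - x)^-1 *: (g y - g x) @[y --> within `[0, 1] x^']).

(* Determined up to a null set, so that integrals of it are well defined. *)
Definition curve_xx (R : realType) (g : R -> 'rV[R]_2) : R -> 'rV[R]_2 :=
  xget (fun=> 0) [set w | weak_second_derivative g w].

Definition length (R : realType) (g : R -> 'rV[R]_2) : R :=
  \int[@lebesgue_measure R]_(x in `[0, 1]) enorm (curve_x g x).

Definition constant_speed (R : realType) (g : R -> 'rV[R]_2) : Prop :=
  forall x : R, x \in `[0, 1] -> enorm (curve_x g x) = length g.

Definition regular (R : realType) (g : R -> 'rV[R]_2) : Prop :=
  forall x : R, x \in `[0, 1] -> enorm (curve_x g x) != 0.

Definition tangent (R : realType) (g : R -> 'rV[R]_2) (x : R) : 'rV[R]_2 :=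
  (enorm (curve_x g x))^-1 *: curve_x g x.

Definition network (R : realType) (G : 'I_3 -> R -> 'rV[R]_2) : Prop :=
  [/\ forall i, class_H2 (G i),
      forall i, constant_speed (G i),
      forall i j, G i 0 = G j 0 &
      forall i j, G i 1 = G j 1].

Definition theta_network (R : realType) (G : 'I_3 -> R -> 'rV[R]_2) : Prop :=
  [/\ network G,
      forall i, regular (G i),
      \sum_(i < 3) tangent (G i) 0 = 0 &
      \sum_(i < 3) tangent (G i) 1 = 0].

Definition degenerate_labelled (R : realType) (g1 g2 g3 : R -> 'rV[R]_2) : Prop :=
  exists P : 'rV[R]_2,
  [/\ regular g1 /\ regular g2,
      forall x : R, x \in `[0, 1] -> g3 x = P,
      [/\ g1 0 = P, g1 1 = P, g2 0 = P & g2 1 = P],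
      angle (tangent g1 0) (tangent g2 0) = 2 * pi / 3 &
      [set tangent g1 0; tangent g2 0] = [set tangent g1 1; tangent g2 1]].

Definition degenerate_theta_network (R : realType)
    (G : 'I_3 -> R -> 'rV[R]_2) : Prop :=
  network G /\
  exists s : 'S_3,
    degenerate_labelled (G (s 0)) (G (s 1)) (G (s 2%:R)).

Definition curve_energy (R : realType) (g : R -> 'rV[R]_2) : R :=
  (length g ^+ 3)^-1 *
    (\int[@lebesgue_measure R]_(x in `[0, 1]) (enorm (curve_xx g x) ^+ 2)) +
  length g.

Definition Fbar (R : realType) (G : 'I_3 -> R -> 'rV[R]_2) : \bar R :=
  if `[< theta_network G >] then (\sum_(i < 3) curve_energy (G i))%:E
  else if `[< degenerate_theta_network G >] then
    (\sum_(i < 3 | 0 < length (G i)) curve_energy (G i))%:E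
  else +oo%E.

(* Main.v *)
(* Direct method. Every admissible network carries unit vectors T0 i, T1 i at the
   two junctions with sum zero and gamma^i_x = L_i T at the endpoints, where a
   curve of length zero is given T0 i = T1 i; conversely such data, with at most
   one vanishing length, characterise Theta- and "degenerate" Theta-networks
   (junction_tangents). For a curve of energy at most M,
   |T1 - T0|^2 <= M L and its chord is L (T0 + e) with |e|^2 <= M L. Since all
   chords coincide while the T0 i form angles of 120 degrees, two curves cannot
   both be short, so all these conditions are closed and pass to the limit of a
   minimising sequence.

   Limits are taken along an ultrafilter, which avoids subsequences. The tangents
   are equi-Hoelder, hence converge uniformly on [0, 1]. The second derivative of
   the limit is found without weak compactness: among the pairs (z, u) with
   u = z' and z uniformly close to the limit tangent, nearly norm-minimal u form
   a Cauchy sequence by the parallelogram identity, and L^2 is complete. *)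
Require Import Defs.
From mathcomp Require Import all_boot all_order all_algebra all_fingroup.
From mathcomp Require Import all_classical all_reals all_analysis.
From mathcomp Require Import measurable_realfun ring lra.
Import Order.TTheory GRing.Theory Num.Theory.
Import numFieldNormedType.Exports.

Set Implicit Arguments.
Unset Strict Implicit.
Unset Printing Implicit Defensive.

Local Open Scope classical_set_scope.
Local Open Scope ring_scope.

(** The condition that no two lengths vanish together is open and would be lost in the limit; what
    passes is the bound 1/64 <= M (L_i + L_j). The constant comes from |e| <= 1/8: the directions
    T_i + e and T_j + e' then have scalar product at most -1/2 + 1/8 + 1/8 + 1/64 < 0, whereas equal
    nonzero chords have a positive one. The equality of the sets of tangents in a degenerate network
    needs no limit argument of its own: if the third curve vanishes, the other two directions add up
    to the same vector -T at both junctions, and two unit vectors at 120 degrees are determined up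
    to order by their sum. Nothing bounds the position of a minimising sequence, so each limit curve
    starts at the origin and only chords are compared. A competitor of finite energy consists of
    three circles through one point, which is allowed because the curves may intersect. *)

Definition Rintegrable (R : realType) (D : set R) (f : R -> R) :=
  (@lebesgue_measure R).-integrable D (EFin \o f).

Lemma ae_lebesgueS (R : realType) (P Q : R -> Prop) :
  (forall x, P x -> Q x) -> {ae @lebesgue_measure R, forall x, P x} ->
  {ae @lebesgue_measure R, forall x, Q x}.
Proof. exact: (@filterS _ _ (ae_filter_ringOfSetsType (@lebesgue_measure R))). Qed.

Lemma ae_lebesgueI (R : realType) (P Q : R -> Prop) :
  {ae @lebesgue_measure R, forall x, P x} ->
  {ae @lebesgue_measure R, forall x, Q x} ->
  {ae @lebesgue_measure R, forall x, P x /\ Q x}.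
Proof. exact: (@filterI _ _ (ae_filter_ringOfSetsType (@lebesgue_measure R))). Qed.

Lemma near_harmonic (R : realType) (e : R) : 0 < e ->
  \forall n \near \oo, n.+1%:R^-1 <= e.
Proof.
move=> e0; have := @cvg_harmonic R => /cvgrPdist_le/(_ _ e0).
by apply: filterS => m; rewrite sub0r normrN ger0_norm// harmonic_ge0.
Qed.

(** * Integrability of real functions on a measurable set *)

Section Rintegrable_theory.
Context {R : realType}.
Local Notation mu := (@lebesgue_measure R).
Variable D : set R.
Hypothesis mD : measurable (D : set (measurableTypeR R)).
Implicit Types f g : R -> R.

Lemma RintegrableD f g :
  Rintegrable D f -> Rintegrable D g -> Rintegrable D (fun x => f x + g x).
Proof.
move=> hf hg.
rewrite /Rintegrable.
by apply: (eq_integrable mD _ _ _ (integrableD mD hf hg)) => x _ /=; rewrite EFinD.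
Qed.

Lemma RintegrableZ a f : Rintegrable D f -> Rintegrable D (fun x => a * f x).
Proof.
move=> hf.
rewrite /Rintegrable.
by apply: (eq_integrable mD _ _ _ (integrableZl mD a hf)) => x _ /=; rewrite EFinM.
Qed.

Lemma RintegrableN f : Rintegrable D f -> Rintegrable D (fun x => - f x).
Proof.
move=> hf; apply: (eq_integrable mD _ _ _ (integrableN hf)) => x _ /=.
by rewrite EFinN.
Qed.

Lemma RintegrableB f g :
  Rintegrable D f -> Rintegrable D g -> Rintegrable D (fun x => f x - g x).
Proof. by move=> hf hg; apply: RintegrableD hf _; exact: RintegrableN. Qed.

Lemma Rintegrable_mfun f : Rintegrable D f -> measurable_fun D f.
Proof. by move/measurable_int/measurable_EFinP. Qed.

Lemma Rintegrable_norm f : Rintegrable D f -> Rintegrable D (fun x => `|f x|).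
Proof. exact: integrable_norm. Qed.

Lemma Rintegrable_le f g : measurable_fun D f -> Rintegrable D g ->
  (forall x, D x -> `|f x| <= g x) -> Rintegrable D f.
Proof.
move=> mf ig fg; apply: (le_integrable mD _ _ ig); first exact/measurable_EFinP.
by move=> x /fg h /=; rewrite lee_fin (le_trans h)// ler_norm.
Qed.

Lemma eq_Rintegrable f g : (forall x, D x -> f x = g x) ->
  Rintegrable D f -> Rintegrable D g.
Proof.
by move=> fg; apply: eq_integrable => // x /set_mem /fg /= ->.
Qed.

Lemma RintegrableS (E : set R) f : measurable (E : set (measurableTypeR R)) ->
  E `<=` D -> Rintegrable D f -> Rintegrable E f.
Proof. by move=> mE ED; exact: integrableS. Qed.

Lemma Rintegral_ae_eq f g : measurable_fun D f -> measurable_fun D g ->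
  {ae mu, forall x, D x -> f x = g x} ->
  \int[mu]_(x in D) f x = \int[mu]_(x in D) g x.
Proof.
move=> hf hg fg; congr fine; apply: ae_eq_integral => //.
- exact/measurable_EFinP.
- exact/measurable_EFinP.
- by apply: ae_lebesgueS fg => x h Dx; rewrite h.
Qed.

Lemma Rintegral_itv_cst (a b c : R) : a <= b ->
  \int[mu]_(x in `[a, b]) c = c * (b - a).
Proof.
move=> ab; rewrite Rintegral_cst//= lebesgue_measure_itv/= lte_fin.
by case: ltgtP ab => //= -> _; rewrite subrr.
Qed.

End Rintegrable_theory.

Lemma ord2_cases (j : 'I_2) : j = 0 \/ j = 1.
Proof. by case: j => -[|[|//]] p; [left|right]; exact: val_inj. Qed.

Lemma sum_ord2 (V : nmodType) (f : 'I_2 -> V) : \sum_(j < 2) f j = f 0 + f 1.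
Proof.
by rewrite big_ord_recl big_ord1; congr (_ + f _); exact: val_inj.
Qed.

(** * Square integrable functions on the unit interval *)

Section unit_interval.
Context {R : realType}.
Local Notation mu := (@lebesgue_measure R).
Local Notation I01 := (`]0, 1[%classic : set R).
Implicit Types f g : R -> R.

(** [L2] unfolds to this condition on each coordinate. *)
Definition sq01 f := f \_ I01 \in Lfun mu 2%:E.

Lemma mI01 : measurable (I01 : set (measurableTypeR R)).
Proof. exact: measurable_itv. Qed.

Lemma measure_I01 : mu I01 = 1%E.
Proof. by rewrite lebesgue_measure_itv/= lte_fin ltr01 sube0. Qed.

Lemma Rintegral_I01_cst (c : R) : \int[mu]_(x in I01) c = c.
Proof.
by rewrite Rintegral_cst//= lebesgue_measure_itv/= lte_fin ltr01 /= subr0 mulr1.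
Qed.

Lemma Rintegral_I01 f : measurable_fun I01 f ->
  \int[mu]_(x in I01) f x = \int[mu]_(x in `[0, 1]) f x.
Proof.
by move=> mf; rewrite /Rintegral (integral_itv_bndoo true false)//;
  exact/measurable_EFinP.
Qed.

Lemma continuous_Rintegrable f :
  {within `[(0 : R), 1], continuous f} -> Rintegrable I01 f.
Proof.
move=> cf; apply: (@integrableS _ _ _ mu `[0, 1]) => //.
  by apply: subset_itv_oo_cc.
by apply: continuous_compact_integrable => //; exact: segment_compact.
Qed.

Lemma Rintegrable_bounded f (M : R) : measurable_fun I01 f ->
  (forall x, I01 x -> `|f x| <= M) -> Rintegrable I01 f.
Proof.
move=> mf fM.
apply: (measurable_bounded_integrable (mu := mu)) => //.
  by rewrite /= measure_I01 ltry.
exists M; split => //; first exact: num_real.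
by move=> N MN x /fM h /=; rewrite (le_trans h)// ltW.
Qed.

Lemma Rintegrable_cst (c : R) : Rintegrable I01 (fun=> c).
Proof. by apply: (@Rintegrable_bounded _ `|c|). Qed.

Lemma Rintegrable_Mbounded f g (M : R) : Rintegrable I01 f ->
  measurable_fun I01 g -> (forall x, I01 x -> `|g x| <= M) ->
  Rintegrable I01 (fun x => f x * g x).
Proof.
move=> hf mg gM.
apply: (Rintegrable_le mI01 _ (RintegrableZ mI01 M (Rintegrable_norm hf))).
  by apply: measurable_funM => //; exact: Rintegrable_mfun.
by move=> x Ix; rewrite normrM mulrC ler_wpM2r// gM.
Qed.

Lemma sq01P f :
  sq01 f <-> measurable_fun I01 f /\ Rintegrable I01 (fun x => f x ^+ 2).
Proof.
have e x : (f \_ I01) x ^+ 2 = ((fun y => f y ^+ 2) \_ I01) x.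
  by rewrite !patchE; case: ifP => // _; rewrite expr0n.
split=> [sf|[mf if2]].
- have mf : measurable_fun I01 f.
    have : measurable_fun setT (f \_ I01).
      by have /sub_Lfun_mfun := sf; rewrite inE.
    by move/(measurable_restrictT f mI01).
  split=> //; rewrite /Rintegrable; apply/(integrable_mkcond _ mI01).
  have := Lfun2_integrable_sqr sf; apply: eq_integrable => // x _ /=.
  by rewrite e !patchE; case: ifP.
- have mF : measurable_fun setT (f \_ I01).
    exact/(measurable_restrictT f mI01).
  apply/andP; split; rewrite inE//=.
  rewrite /finite_norm unlock /=.
  apply: poweR_lty.
  move: if2; rewrite /Rintegrable => /(integrable_mkcond _ mI01)/integrableP[_].
  apply: le_lt_trans; apply: ge0_le_integral => //=.
  + apply/measurable_EFinP; apply: (measurableT_comp (measurable_powR _)).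
    exact: measurableT_comp.
  + apply: measurableT_comp => //; apply/(measurable_restrictT _ mI01).
    by apply/measurable_EFinP; apply: measurable_funX.
  + move=> x _; rewrite powR_mulrn// -normrX e !patchE /=.
    by case: ifP => //=; rewrite normr0.
Qed.

Lemma sq01_mfun f : sq01 f -> measurable_fun I01 f.
Proof. by case/sq01P. Qed.

Lemma sq01_sqr f : sq01 f -> Rintegrable I01 (fun x => f x ^+ 2).
Proof. by case/sq01P. Qed.

(** The product is dominated by [f x ^+ 2 + g x ^+ 2], which spares the Hölder inequality. *)
Lemma sq01M f g : sq01 f -> sq01 g -> Rintegrable I01 (fun x => f x * g x).
Proof.
move=> /sq01P[mf if2] /sq01P[mg ig2].
apply: (Rintegrable_le mI01 _ (RintegrableD mI01 if2 ig2)).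
  exact: measurable_funM.
move=> x _; rewrite ler_norml; apply/andP; split; nra.
Qed.

Lemma sq01_int f : sq01 f -> Rintegrable I01 f.
Proof.
move=> /sq01P[mf if2].
apply: (Rintegrable_le mI01 _ (RintegrableD mI01 if2 (Rintegrable_cst 1))) => //.
by move=> x _; rewrite ler_norml; apply/andP; split; nra.
Qed.

Lemma sq01D f g : sq01 f -> sq01 g -> sq01 (fun x => f x + g x).
Proof.
move=> hf hg; apply/sq01P; split.
  by apply: measurable_funD; exact: sq01_mfun.
apply: (@eq_Rintegrable _ _ mI01 (fun x => (f x ^+ 2 + g x ^+ 2) + 2 * (f x * g x))).
  by move=> x _; ring.
apply: RintegrableD; [exact: mI01| |].
  by apply: RintegrableD; [exact: mI01| exact: sq01_sqr..].
by apply: RintegrableZ; [exact: mI01| exact: sq01M].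
Qed.

Lemma sq01Z a f : sq01 f -> sq01 (fun x => a * f x).
Proof.
move=> hf; apply/sq01P; split.
  by apply: measurable_funM => //; exact: sq01_mfun.
apply: (@eq_Rintegrable _ _ mI01 (fun x => a ^+ 2 * f x ^+ 2)).
  by move=> x _; ring.
by apply: RintegrableZ; [exact: mI01| exact: sq01_sqr].
Qed.

Lemma sq01B f g : sq01 f -> sq01 g -> sq01 (fun x => f x - g x).
Proof.
move=> hf hg; have := sq01D hf (sq01Z (-1) hg).
by under eq_fun do rewrite mulN1r.
Qed.

Lemma sq01_bounded f (M : R) : measurable_fun I01 f ->
  (forall x, I01 x -> `|f x| <= M) -> sq01 f.
Proof.
move=> mf fM; apply/sq01P; split=> //.
apply: (@Rintegrable_bounded _ (M ^+ 2)); first exact: measurable_funX.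
move=> x Ix; rewrite normrX lerXn2r ?nnegrE ?fM//.
by rewrite (le_trans _ (fM _ Ix)).
Qed.

End unit_interval.
#[local] Hint Resolve mI01 : core.

(** * Compactly supported test functions and weak derivatives *)

(** Meant for max(x, 0)^2, whose derivative has a kink: a quadratic remainder gives the derivative
    uniformly, without separating the sign of the point. *)
Lemma is_derive_quadratic (R : realType) (f : R -> R) (x l C : R) :
  (forall h, `|f (x + h) - f x - l * h| <= C * h ^+ 2) -> is_derive x 1 f l.
Proof.
move=> H.
have C0 : 0 <= C.
  by have := H 1; rewrite expr1n !mulr1 => /(le_trans _); apply.
have cv : h^-1 *: (f (h *: 1 + x) - f x) @[h --> 0^'] --> l.
  apply/cvgrPdist_le => e e0.
  near=> h.
  have h0 : h != 0 by near: h; exact: nbhs_dnbhs_neq.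
  rewrite scaler1 /= (_ : l - _ = - (f (x + h) - f x - l * h) / h); last first.
    by rewrite [h + x]addrC [_ *: _]/GRing.scale /=; field.
  rewrite normrM normrN normfV ler_pdivrMr ?normr_gt0//.
  apply: (le_trans (H h)); rewrite -real_normK ?num_real// expr2 mulrA.
  rewrite ler_wpM2r//.
  have hC : `|h| <= e / (C + 1).
    by near: h; apply: dnbhs0_le; rewrite divr_gt0// ltr_wpDl.
  have := ler_wpM2l C0 hC; move=> /le_trans; apply.
  by rewrite mulrA ler_pdivrMr ?ltr_wpDl//; nra.
apply: DeriveDef; first by apply/cvg_ex; exists l.
exact: cvg_lim cv.
Unshelve. all: by end_near. Qed.

Section ramp.
Context {R : realType}.
Implicit Types a d x h : R.

Let pos x := Num.max x 0.

(** The remainder is quadratic because the derivative 2 max(x, 0) is 2-Lipschitz. *)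
Let pos_sqr x h :
  `|pos (x + h) ^+ 2 - pos x ^+ 2 - 2 * pos x * h| <= h ^+ 2.
Proof.
by rewrite ler_norml /pos; case: (leP x 0); case: (leP (x + h) 0) => *;
  apply/andP; split; nra.
Qed.

(* [ramp a d] is a second difference of [x |-> max(x, 0)^2]: a C^1 step from 0
   to 1 across [a - d, a + d], with derivative the tent [hat a d]. *)
Definition hat a d x : R :=
  (Num.max (x - a + d) 0 - 2 * Num.max (x - a) 0 + Num.max (x - a - d) 0)
  / d ^+ 2.

Definition ramp a d x : R :=
  (Num.max (x - a + d) 0 ^+ 2 - 2 * Num.max (x - a) 0 ^+ 2
   + Num.max (x - a - d) 0 ^+ 2) / (2 * d ^+ 2).

Lemma hat_continuous a d : continuous (hat a d).
Proof.
have cm (b : R) : continuous (fun x : R => Num.max (x - a + b) 0).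
  move=> x; apply: (@continuous_max R R (fun x => x - a + b) (fun=> 0)).
    by apply: cvgD; [apply: cvgB; [exact: cvg_id|exact: cvg_cst]|exact: cvg_cst].
  exact: cvg_cst.
move=> x; apply: cvgM; last exact: cvg_cst.
apply: cvgD; last exact: cm.
apply: cvgB; first exact: cm.
apply: cvgM; first exact: cvg_cst.
by have := cm 0 x; under eq_fun do rewrite addr0.
Qed.

Lemma is_derive_ramp a d x : 0 < d -> is_derive x 1 (ramp a d) (hat a d x).
Proof.
(* The three remainders enter with weights 1, 2, 1, hence 4 h^2 in all, divided by 2 d^2. *)
move=> d0; apply: (@is_derive_quadratic _ _ _ _ (2 / d ^+ 2)) => h.
have e1 := pos_sqr (x - a + d) h.
have e2 := pos_sqr (x - a) h.
have e3 := pos_sqr (x - a - d) h.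
have d2 : 0 < d ^+ 2 by rewrite exprn_gt0.
rewrite (_ : _ - _ = ((pos (x - a + d + h) ^+ 2 - pos (x - a + d) ^+ 2
     - 2 * pos (x - a + d) * h)
   - 2 * (pos (x - a + h) ^+ 2 - pos (x - a) ^+ 2 - 2 * pos (x - a) * h)
   + (pos (x - a - d + h) ^+ 2 - pos (x - a - d) ^+ 2
     - 2 * pos (x - a - d) * h)) / (2 * d ^+ 2)); last first.
  rewrite /ramp /hat -/(pos _) -!/(pos _).
  rewrite (_ : x + h - a + d = x - a + d + h); last by ring.
  rewrite (_ : x + h - a - d = x - a - d + h); last by ring.
  rewrite (_ : x + h - a = x - a + h); last by ring.
  by field; rewrite gt_eqF.
have dd : 0 <= (2 * d ^+ 2)^-1 by rewrite invr_ge0 ltW// mulr_gt0.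
rewrite normrM (ger0_norm dd).
rewrite ler_pdivrMr ?mulr_gt0//.
rewrite (_ : 2 / d ^+ 2 * h ^+ 2 * (2 * d ^+ 2) = 4 * h ^+ 2); last first.
  by field; rewrite gt_eqF.
move: e1 e2 e3; rewrite !ler_norml => /andP[? ?] /andP[? ?] /andP[? ?].
by apply/andP; split; lra.
Qed.

Lemma ramp_left a d x : 0 < d -> x <= a - d -> ramp a d x = 0.
Proof.
move=> d0 xa; by rewrite /ramp !max_r; lra.
Qed.

Lemma ramp_right a d x : 0 < d -> a + d <= x -> ramp a d x = 1.
Proof.
move=> d0 xa; rewrite /ramp !max_l; try lra.
by field; rewrite gt_eqF.
Qed.

Lemma ramp_bound a d x : 0 < d -> 0 <= ramp a d x <= 1.
Proof.
move=> d0; have d2 : 0 < 2 * d ^+ 2 by rewrite mulr_gt0// exprn_gt0.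
rewrite /ramp ler_pdivlMr// ler_pdivrMr// mul0r mul1r.
case: (leP (x - a + d) 0); case: (leP (x - a) 0); case: (leP (x - a - d) 0) => *;
 apply/andP; split; nra.
Qed.

Lemma hat_ge0 a d x : 0 < d -> 0 <= hat a d x.
Proof.
move=> d0; have d2 : 0 < d ^+ 2 by rewrite exprn_gt0.
have dd : 0 <= (d ^+ 2)^-1 by rewrite invr_ge0 ltW.
rewrite /hat mulr_ge0//.
case: (leP (x - a + d) 0); case: (leP (x - a) 0); case: (leP (x - a - d) 0) => *;
 lra.
Qed.

Lemma hat_le a d x : 0 < d -> hat a d x <= d^-1.
Proof.
move=> d0; have d2 : 0 < d ^+ 2 by rewrite exprn_gt0.
rewrite /hat ler_pdivrMr// expr2 mulKf ?gt_eqF//.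
case: (leP (x - a + d) 0); case: (leP (x - a) 0); case: (leP (x - a - d) 0) => *;
 lra.
Qed.

Lemma hat_out a d x : 0 < d -> d <= `|a - x| -> hat a d x = 0.
Proof.
move=> d0; rewrite /hat ler_normr => /orP[h|h].
  by rewrite !max_r; lra.
by rewrite !max_l; lra.
Qed.

Lemma ramp_continuous a d : 0 < d -> continuous (ramp a d).
Proof.
move=> d0 x; apply: differentiable_continuous.
by apply/derivable1_diffP; have [] := is_derive_ramp a x d0.
Qed.

Lemma Rintegral_hat a d : 0 < d -> 0 <= a - d -> a + d <= 1 ->
  \int[@lebesgue_measure R]_(x in `]0, 1[) hat a d x = 1.
Proof.
move=> d0 ad0 ad1.
have ch : {within `[(0:R), 1], continuous (hat a d)}.
  by apply: continuous_subspaceT; exact: hat_continuous.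
rewrite Rintegral_I01; last first.
  by apply: Rintegrable_mfun; exact: continuous_Rintegrable.
rewrite /Rintegral (continuous_FTC2 (F := ramp a d))//.
- by rewrite ramp_right// ramp_left// ?add0r ?sube0 //; lra.
- split.
  + by move=> x _; have [] := is_derive_ramp a x d0.
  + exact/cvg_at_right_filter/ramp_continuous.
  + exact/cvg_at_left_filter/ramp_continuous.
- move=> x _; rewrite derive1E.
  by have [_ ->] := is_derive_ramp a x d0.
Qed.

End ramp.

Definition weak01 (R : realType) (u v : R -> R) :=
  forall phi : R -> R, test_function phi ->
  \int[@lebesgue_measure R]_(x in `]0, 1[) (u x * derive1 phi x) =
  - \int[@lebesgue_measure R]_(x in `]0, 1[) (v x * phi x).

Section weak_derivative_theory.
Context {R : realType}.
Local Notation mu := (@lebesgue_measure R).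
Local Notation I01 := (`]0, 1[%classic : set R).
Implicit Types u v w : R -> R.

Lemma Rdominated_cvg (f_ : nat -> R -> R) (f g : R -> R) :
  (forall n, measurable_fun I01 (f_ n)) -> measurable_fun I01 f ->
  {ae mu, forall x, I01 x -> f_ ^~ x @ \oo --> f x} ->
  Rintegrable I01 g -> (forall n x, I01 x -> `|f_ n x| <= g x) ->
  \int[mu]_(x in I01) f_ n x @[n --> \oo] --> \int[mu]_(x in I01) f x.
Proof.
move=> mf_ mf ff ig fg.
have [] := @dominated_convergence _ _ _ mu I01 mI01
  (fun n x => (f_ n x)%:E) (fun x => (f x)%:E) (EFin \o g).
- by move=> n; apply/measurable_EFinP; exact: mf_.
- exact/measurable_EFinP.
- apply: ae_lebesgueS ff => x h Ix; apply: cvg_EFin; last exact: h.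
  by apply: nearW.
- exact: ig.
- by apply: aeW => x n Ix; rewrite /= lee_fin fg.
move=> i_f _ h.
apply: (@fine_cvg _ _ _ _ (fun n => \int[mu]_(x in I01) (f_ n x)%:E)%E).
by rewrite /Rintegral fineK// integrable_fin_num.
Qed.

Lemma ae_neq (a : R) : {ae mu, forall x, x != a}.
Proof.
exists [set a]; split => //; first exact: lebesgue_measure_set1.
by move=> x /= /negP; rewrite negbK => /eqP.
Qed.

(** The tents are an approximate identity: mass 1, height at most 1/d, support in the ball of radius
    d. Since this ball has length 2 d, the error is at most twice the mean deviation [davg] of [u]
    from [u a], which tends to 0 at a Lebesgue point. *)
Lemma cvg_hat_lebesgue_pt u (a : R) : Rintegrable I01 u -> I01 a ->
  lebesgue_pt (u \_ I01) a ->
  \int[mu]_(x in I01) (u x * hat a n.+1%:R^-1 x) @[n --> \oo] --> u a.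
Proof.
move=> iu Ia lp.
have d0 n : 0 < n.+1%:R^-1 :> R by [].
have mh n : measurable_fun I01 (hat a n.+1%:R^-1).
  by apply: Rintegrable_mfun; apply: continuous_Rintegrable;
    apply: continuous_subspaceT; exact: hat_continuous.
have ih n f : Rintegrable I01 f -> Rintegrable I01 (fun x => f x * hat a n.+1%:R^-1 x).
  move=> iF; apply: (@Rintegrable_Mbounded _ _ _ n.+1%:R) => // x _.
  by rewrite ger0_norm ?hat_ge0// (le_trans (hat_le _ _ _))// invrK.
have dl : (fun n => davg (u \_ I01) a n.+1%:R^-1) @ \oo --> 0%E.
  apply: cvg_comp lp => A [e /= e0 eA].
  have := @cvg_harmonic R => /cvgrPdist_lt/(_ _ e0).
  apply: filterS => n hn; apply: eA => //=.
move: Ia => /=; rewrite in_itv/= => /andP[a0 a1].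
apply/cvgrPdist_le => e e0.
have m0 : 0 < Num.min a (1 - a) by rewrite lt_min a0 subr_gt0.
have e2 : 0 < e / 2 by rewrite divr_gt0.
near=> n.
set d : R := n.+1%:R^-1.
have da : d <= a /\ d <= 1 - a.
  suff : d <= Num.min a (1 - a) by rewrite le_min => /andP[].
  by rewrite /d; near: n; exact: near_harmonic.
have -> : u a - \int[mu]_(x in I01) (u x * hat a d x) =
    - \int[mu]_(x in I01) ((u x - u a) * hat a d x).
  under [in RHS]eq_Rintegral do rewrite mulrBl.
  rewrite RintegralB//; last 2 first.
  - exact: ih.
  - by apply: ih; exact: Rintegrable_cst.
  rewrite RintegralZl//; last first.
    by apply: continuous_Rintegrable; apply: continuous_subspaceT; exact: hat_continuous.
  by rewrite Rintegral_hat//; [ring|exact: d0|lra|lra].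
have ii : Rintegrable I01 (fun x => (u x - u a) * hat a d x).
  by apply: ih; apply: RintegrableB => //; exact: Rintegrable_cst.
rewrite normrN (le_trans (le_normr_Rintegral _ _))//.
have hd : (davg (u \_ I01) a d <= (e / 2)%:E)%E.
  rewrite /d; near: n.
  have [fd /cvgrPdist_le/(_ _ e2)] := (fine_cvgP _ _).1 dl.
  apply: filterS2 fd => m fm; rewrite sub0r normrN ger0_norm.
    by move=> h; rewrite -(fineK fm) lee_fin.
  by rewrite fine_ge0// davg_ge0.
have da' : 0 < d by exact: d0.
have bI : ball a d `<=` I01.
  move=> y; rewrite ball_itv /= !in_itv /= => /andP[y0 y1].
  apply/andP; split; first by apply: le_lt_trans y0; rewrite subr_ge0 da.1.
  by apply: (lt_le_trans y1); rewrite -lerBrDl da.2.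
have mb : measurable (ball a d : set (measurableTypeR R)) by exact: measurable_ball.
set U := u \_ I01 in hd.
have UE y : I01 y -> U y = u y by move=> Iy; rewrite /U patchE mem_set.
have mUa : measurable_fun (ball a d) (fun y => `|U y - U a|).
  apply: measurableT_comp => //.
  apply: measurable_funB => //.
  apply: (measurable_funS mI01 bI).
  apply: (eq_measurable_fun u) => [y /set_mem /UE //|].
  exact: Rintegrable_mfun.
have mUb : measurable_fun (ball a d) (fun y => d^-1 * `|U y - U a|).
  exact: measurable_funM.
have fin2 : davg U a d \is a fin_num.
  by rewrite ge0_fin_numE ?davg_ge0// (le_lt_trans hd)// ltry.
rewrite (_ : e = fine (2%:E * (e / 2)%:E)%E); last by rewrite /= mulrC divfK.
rewrite -lee_fin.
rewrite /Rintegral fineK; last first.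
  by apply: integrable_fin_num => //; exact: (Rintegrable_norm ii).
rewrite fineK//; apply: (@le_trans _ _ (2%:E * davg U a d)%E); last first.
  by apply: lee_wpmul2l.
have -> : (2%:E * davg U a d = \int[mu]_(y in ball a d) (d^-1 * `|U y - U a|)%:E)%E.
  rewrite /davg /iavg lebesgue_measure_ball ?ltW// muleA.
  under [RHS]eq_integral do rewrite EFinM.
  rewrite ge0_integralZl//=.
  - congr (_ * _)%E; rewrite inver mulrn_eq0/= gt_eqF//.
    transitivity ((2 * (d *+ 2)^-1)%:E) => //.
    by apply: f_equal; rewrite -(mulr_natl d 2) invfM mulrA divff// mul1r.
  - exact/measurable_EFinP.
  - by rewrite lee_fin invr_ge0 ltW.
rewrite -{1}(setIidr bI) integral_mkcondr.
apply: ge0_le_integral => //=.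
- by apply/measurable_EFinP; exact: Rintegrable_mfun (Rintegrable_norm ii).
- rewrite -(setIidr bI) in mUb.
  by apply/(measurable_restrict _ mb mI01)/measurable_EFinP.
- move=> x Ix; rewrite patchE; case: ifPn => [/set_mem|/negP] xb.
    rewrite UE// UE; last by rewrite /= in_itv /= a0.
    rewrite lee_fin normrM mulrC ler_wpM2r// ger0_norm ?hat_ge0//.
    exact: hat_le.
  rewrite hat_out ?mulr0 ?normr0//.
  by rewrite leNgt; apply/negP => h; apply: xb; rewrite inE /ball /=.
Unshelve. all: by end_near.
Qed.

End weak_derivative_theory.

(** * Increments of weakly differentiable functions *)

Section du_bois_reymond.
Context {R : realType}.
Local Notation mu := (@lebesgue_measure R).
Local Notation I01 := (`]0, 1[%classic : set R).
Implicit Types u v w : R -> R.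

Lemma derive1_rampB (a b d x : R) : 0 < d ->
  is_derive x 1 (fun x => ramp a d x - ramp b d x) (hat a d x - hat b d x).
Proof.
by move=> d0; apply: is_deriveB; exact: is_derive_ramp.
Qed.

Lemma test_function_ramp (a b d : R) : 0 < d -> a <= b -> d < a -> b + d < 1 ->
  test_function (fun x => ramp a d x - ramp b d x).
Proof.
move=> d0 ab da bd; split.
- by move=> x; have [] := derive1_rampB a b x d0.
- rewrite (_ : derive1 _ = fun x => hat a d x - hat b d x).
    by move=> x; apply: cvgB; exact: hat_continuous.
  by apply/funext => x; rewrite derive1E; have [_ ->] := derive1_rampB a b x d0.
- apply: (@subset_trans _ `[a - d, b + d]).
    rewrite [X in _ `<=` X](closure_id _).1; last exact: interval_closed.
    apply: closureS => x /= h; rewrite in_itv /=.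
    apply/andP; split; rewrite leNgt; apply/negP => hx; move/eqP: h; apply.
      by rewrite !ramp_left ?subrr//; lra.
    by rewrite !ramp_right ?subrr//; lra.
  by move=> x /=; rewrite !in_itv /= => /andP[? ?]; apply/andP; split; lra.
Qed.

(* Test with C^1 approximations of the indicator of [a, b]. *)
Lemma weak01_lebesgue_pt u v (a b : R) :
  Rintegrable I01 u -> Rintegrable I01 v -> weak01 u v ->
  0 < a -> a < b -> b < 1 ->
  lebesgue_pt (u \_ I01) a -> lebesgue_pt (u \_ I01) b ->
  u b - u a = \int[mu]_(x in `[a, b]) v x.
Proof.
move=> iu iv uv a0 ab b1 la lb.
have Ia : I01 a by rewrite /= in_itv /= a0 (lt_trans ab).
have Ib : I01 b by rewrite /= in_itv /= b1 andbT (lt_trans a0).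
have ca := cvg_hat_lebesgue_pt iu Ia la.
have cb := cvg_hat_lebesgue_pt iu Ib lb.
have d0 n : 0 < n.+1%:R^-1 :> R by [].
pose phi n x : R := ramp a n.+1%:R^-1 x - ramp b n.+1%:R^-1 x.
have sub : `[a, b] `<=` I01.
  by move=> x /=; rewrite !in_itv /= => /andP[? ?]; apply/andP; split; lra.
(* At [a] and [b] themselves the approximations are eventually 1/2, so they converge to the
   indicator only off these two points. *)
have c1 : \int[mu]_(x in I01) (v x * phi n x) @[n --> \oo] -->
    \int[mu]_(x in I01) (v \_ `[a, b]) x.
  apply: (@Rdominated_cvg _ _ _ (fun x => `|v x|)).
  - move=> n; apply: measurable_funM; first exact: Rintegrable_mfun.
    by apply: Rintegrable_mfun; apply: continuous_Rintegrable;
      apply: continuous_subspaceT => x; apply: cvgB; exact: ramp_continuous.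
  - have mv : measurable_fun `[a, b] v.
      by apply: (measurable_funS mI01 sub); exact: Rintegrable_mfun.
    by apply/(measurable_restrict _ _ mI01) => //; rewrite setIidr.
  - apply: ae_lebesgueS (ae_lebesgueI (ae_neq a) (ae_neq b)) => x [xa xb] Ix.
    have : \forall n \near \oo, n.+1%:R^-1 <= Num.min `|x - a| `|x - b|.
      by apply: near_harmonic; rewrite lt_min !normr_gt0 !subr_eq0 xa xb.
    move=> H; apply: cvg_near_cst; apply: filterS H => n.
    rewrite le_min => /andP[ha hb].
    have -> : (v \_ `[a, b]) x = if x \in `[a, b]%classic then v x else 0 by [].
    rewrite /phi; move: ha hb (d0 n); move: n.+1%:R^-1 => d ha hb dp.
    have [xla|alx|xE] := ltgtP x a; last by rewrite xE eqxx in xa.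
    + rewrite ler0_norm in ha; last by lra.
      rewrite memNset; last by rewrite /= in_itv /=; lra.
      by rewrite !ramp_left ?subrr ?mulr0//; lra.
    + rewrite ger0_norm in ha; last by lra.
      have [xlb|blx|xE] := ltgtP x b; last by rewrite xE eqxx in xb.
      * rewrite ler0_norm in hb; last by lra.
        rewrite mem_set; last by rewrite /= in_itv /= !ltW.
        by rewrite ramp_right ?ramp_left ?subr0 ?mulr1//; lra.
      * rewrite ger0_norm in hb; last by lra.
        rewrite memNset; last by rewrite /= in_itv /=; lra.
        by rewrite !ramp_right ?subrr ?mulr0//; lra.
  - exact: Rintegrable_norm.
  - move=> n x _; rewrite normrM ler_piMr// /phi.
    have /andP[? ?] := ramp_bound a x (d0 n).
    have /andP[? ?] := ramp_bound b x (d0 n).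
    by rewrite ler_norml; apply/andP; split; lra.
(* The derivative of [phi n] is a tent at [a] minus a tent at [b]; the sign in the weak derivative
   turns this into [u b - u a]. *)
have c2 : \int[mu]_(x in I01) (v x * phi n x) @[n --> \oo] --> u b - u a.
  apply: cvg_trans (cvgB cb ca); apply: near_eq_cvg.
  (* Halving upgrades the large inequality of [near_harmonic] to the strict ones that keep the
     support inside the open interval. *)
  have m0 : 0 < Num.min a (1 - b) / 2 by rewrite divr_gt0// lt_min a0 subr_gt0.
  apply: filterS (near_harmonic m0) => n hn.
  have [h1 h2] : n.+1%:R^-1 < a /\ n.+1%:R^-1 < 1 - b.
    have : n.+1%:R^-1 < Num.min a (1 - b).
      by apply: (le_lt_trans hn); rewrite ltr_pdivrMr// ltr_pMr ?ltr1n// lt_min a0 subr_gt0.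
    by rewrite lt_min => /andP[].
  have tf : test_function (phi n).
    by apply: test_function_ramp => //; [exact: ltW|rewrite -ltrBrDl].
  have mh c : measurable_fun I01 (hat c n.+1%:R^-1).
    by apply: Rintegrable_mfun; apply: continuous_Rintegrable;
      apply: continuous_subspaceT; exact: hat_continuous.
  have ih c : Rintegrable I01 (fun x => u x * hat c n.+1%:R^-1 x).
    apply: (@Rintegrable_Mbounded _ _ _ n.+1%:R) => // x _.
    by rewrite ger0_norm ?hat_ge0// (le_trans (hat_le _ _ _))// invrK.
  rewrite /= -[LHS]opprK -[RHS]opprK -(uv _ tf) opprB /= -RintegralB; [|exact: mI01|exact: ih..].
  congr (- _); apply: eq_Rintegral => x _; rewrite derive1E -mulrBr.
  by have [_ ->] := derive1_rampB a b x (d0 n).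
rewrite -(setIidr sub) Rintegral_mkcondr.
exact: (cvg_unique _ c2 c1).
Qed.

End du_bois_reymond.

(** * Primitives and the regularity of weakly differentiable functions *)

(** F' = f in integral form: it reaches the endpoints, makes sense for [f] merely integrable, and is
    preserved when the integrands converge uniformly. *)
Definition primitive01 (R : realType) (F f : R -> R) :=
  forall x y, 0 <= x -> x <= y -> y <= 1 ->
  F y - F x = \int[@lebesgue_measure R]_(t in `[x, y]) f t.

Section primitive01_theory.
Context {R : realType}.
Local Notation mu := (@lebesgue_measure R).
Local Notation I01 := (`]0, 1[%classic : set R).
Implicit Types u v w f g F : R -> R.

Lemma Rintegrable_cc f : Rintegrable I01 f -> Rintegrable `[0, 1] f.
Proof.
move=> /integrableP[mf fy]; apply/integrableP; split.
  exact: emeasurable_fun_itv_cc mf.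
by rewrite (integral_itv_bndoo true false)//; exact: measurableT_comp.
Qed.

Lemma Rintegrable_sub01 (x y : R) f : 0 <= x -> y <= 1 -> Rintegrable I01 f ->
  Rintegrable `[x, y] f.
Proof.
move=> x0 y1 /Rintegrable_cc; apply: RintegrableS => //.
by apply: subset_itvScc; rewrite bnd_simp.
Qed.

Lemma primitive01_int f : Rintegrable I01 f ->
  primitive01 (fun x => \int[mu]_(t in `[0, x]) f t) f.
Proof.
move=> hf x y x0 xy y1.
have iy : Rintegrable `[0, y] f by exact: Rintegrable_sub01.
rewrite Rintegral_itvB ?bnd_simp// Rintegral_itv_obnd_cbnd//.
apply: (RintegrableS _ _ _ iy) => //.
by apply: subset_itvr; rewrite bnd_simp.
Qed.

Lemma primitive01_continuous F f : Rintegrable I01 f -> primitive01 F f ->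
  {within `[(0:R), 1], continuous F}.
Proof.
move=> hf Ff.
have h := parameterized_integral_continuous ler01 (Rintegrable_cc hf).
have : {within `[(0:R), 1], continuous
    (fun x => F 0 + parameterized_integral mu 0 x f)}.
  by move=> x; apply: cvgD; [exact: cvg_cst|exact: h].
apply: subspace_eq_continuous => x; rewrite inE /= in_itv /= => /andP[x0 x1].
by rewrite /from_subspace /parameterized_integral -(Ff 0 x)// addrC subrK.
Qed.

Lemma primitive01B F G f g : Rintegrable I01 f -> Rintegrable I01 g ->
  primitive01 F f -> primitive01 G g ->
  primitive01 (fun x => F x - G x) (fun x => f x - g x).
Proof.
move=> hf hg Ff Gg x y x0 xy y1.
rewrite RintegralB//; last 2 first.
- exact: Rintegrable_sub01.
- exact: Rintegrable_sub01.
by rewrite -(Ff x y)// -(Gg x y)//; ring.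
Qed.

Lemma ae_lebesgue_pt f : Rintegrable I01 f ->
  {ae mu, forall x, lebesgue_pt (f \_ I01) x}.
Proof.
by move=> hf; apply: lebesgue_differentiation; exact: integrable_locally.
Qed.

(** At a Lebesgue point [f] is the derivative of its integral from 0, and that integral vanishes
    identically. *)
Lemma primitive01_eq0 f : Rintegrable I01 f -> primitive01 (fun=> 0) f ->
  {ae mu, forall x, I01 x -> f x = 0}.
Proof.
move=> hf f0; apply: ae_lebesgueS (ae_lebesgue_pt hf) => x lx Ix.
have x0 : 0 < x by move: Ix; rewrite /= in_itv /= => /andP[].
have x1 : x < 1 by move: Ix; rewrite /= in_itv /= => /andP[].
have mf : measurable_fun I01 f by exact: Rintegrable_mfun hf.
have e0 y : 0 <= y -> y < 1 -> \int[mu]_(t in `[0, y]) (f \_ I01) t = 0.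
  move=> y0 y1; transitivity (\int[mu]_(t in `[0, y]) f t); last first.
    by rewrite -f0 ?subrr// ltW.
  have s : `]0, y[ `<=` I01 by apply: subset_itvl; rewrite bnd_simp ltW.
  congr fine; apply: eq_integral_itv_bounded.
  - apply: (measurable_funS (E := setT)) => //.
    exact/(measurable_restrictT _ mI01).
  - exact: measurable_funS mf.
  - by move=> t ty; rewrite patchE mem_set//; exact: s.
have iF : mu.-integrable `[0, 1] (EFin \o (f \_ I01)).
  apply: integrableS (subsetT _) _ => //; rewrite -restrict_EFin.
  exact/(integrable_mkcond _ mI01).
have [] := @FTC1_lebesgue_pt _ (f \_ I01) (BLeft 0) x 1 x1 iF _ lx.
  by rewrite (@lte_fin R).
rewrite /= patchE mem_set// => _ <-.
rewrite derive1E (@near_eq_derive _ _ _ _ (fun=> 0 : R)) ?derive_cst//.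
near=> y; apply: e0; first by apply: ltW; near: y; exact: lt_nbhsr.
by near: y; exact: lt_nbhsl.
Unshelve. all: by end_near. Qed.

Lemma primitive01_inj F f g : Rintegrable I01 f -> Rintegrable I01 g ->
  primitive01 F f -> primitive01 F g -> {ae mu, forall x, I01 x -> f x = g x}.
Proof.
move=> hf hg Ff Fg.
have h : Rintegrable I01 (fun x => f x - g x) by exact: RintegrableB.
have : primitive01 (fun=> 0) (fun x => f x - g x).
  have := primitive01B hf hg Ff Fg.
  by under [in X in X -> _]eq_fun do rewrite subrr.
move/(primitive01_eq0 h); apply: ae_lebesgueS => x /[apply] /eqP.
by rewrite subr_eq0 => /eqP.
Qed.

(** Increments between Lebesgue points are integrals of [v], so anchoring the primitive at one such
    point fixes it at all of them. *)
Lemma weak01_primitive u v : Rintegrable I01 u -> Rintegrable I01 v ->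
  weak01 u v ->
  exists2 F, primitive01 F v &
    forall x, I01 x -> lebesgue_pt (u \_ I01) x -> u x = F x.
Proof.
move=> hu hv uv.
pose V x := \int[mu]_(t in `[0, x]) v t.
have pV : primitive01 V v by exact: primitive01_int.
(* Without any Lebesgue point in the interval the second claim is vacuous, so their existence need
   not be proved. *)
have [[b Ib lb]|nb] := pselect (exists2 b, I01 b & lebesgue_pt (u \_ I01) b).
- exists (fun x => u b - V b + V x).
    by move=> x y x0 xy y1; rewrite -(pV x y)//; ring.
  move=> x; rewrite /= in_itv /= => /andP[x0 x1] lx.
  move: Ib; rewrite /= in_itv /= => /andP[b0 b1].
  have [xb|bx|->] := ltgtP x b; last by ring.
  + have := weak01_lebesgue_pt hu hv uv x0 xb b1 lx lb.
    by rewrite -(pV x b) ?ltW// => e; rewrite -addrA [- _ + _]addrC -opprB -e; ring.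
  + have := weak01_lebesgue_pt hu hv uv b0 bx x1 lb lx.
    by rewrite -(pV b x) ?ltW// => e; rewrite -addrA [- _ + _]addrC -e; ring.
- by exists V => // x Ix lx; case: nb; exists x.
Qed.

Lemma eq_continuous01 F (G : R -> R) : {within `[(0:R), 1], continuous F} ->
  {within `[(0:R), 1], continuous G} -> (forall x, I01 x -> F x = G x) ->
  forall x, 0 <= x <= 1 -> F x = G x.
Proof.
move=> /(continuous_within_itvP _ ltr01)[cF F0 F1].
move=> /(continuous_within_itvP _ ltr01)[cG G0 G1] FG x /andP[].
rewrite le_eqVlt => /predU1P[<- _|x0].
  suff h : F y @[y --> 0^'+] --> G 0 by exact: (cvg_unique _ F0 h).
  apply: cvg_trans G0; apply: near_eq_cvg.
  near=> y; rewrite FG//= in_itv /=.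
  by apply/andP; split; near: y; [exact: nbhs_right_gt|exact: nbhs_right_lt].
rewrite le_eqVlt => /predU1P[->|x1].
  suff h : F y @[y --> 1^'-] --> G 1 by exact: (cvg_unique _ F1 h).
  apply: cvg_trans G1; apply: near_eq_cvg.
  near=> y; rewrite FG//= in_itv /=.
  by apply/andP; split; near: y; [exact: nbhs_left_gt|exact: nbhs_left_lt].
by rewrite FG//= in_itv /= x0.
Unshelve. all: by end_near. Qed.

(** Every interior point of a continuous function is a Lebesgue point; the endpoints follow by
    continuity of both sides. *)
Lemma weak01_continuous_primitive u v : {within `[(0:R), 1], continuous u} ->
  Rintegrable I01 v -> weak01 u v -> primitive01 u v.
Proof.
move=> cu hv uv.
have hu : Rintegrable I01 u by exact: continuous_Rintegrable.
have [F Fv uF] := weak01_primitive hu hv uv.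
have E : forall x, 0 <= x <= 1 -> u x = F x.
  apply: (eq_continuous01 cu (primitive01_continuous hv Fv)) => x Ix.
  apply: uF => //.
  apply: (@continuous_lebesgue_pt _ _ _ I01) => //.
  - apply: (measurable_funS measurableT (subsetT _)).
    by apply/(measurable_restrictT _ mI01); exact: Rintegrable_mfun.
  - have /(continuous_within_itvP _ ltr01)[cF _ _] := cu.
    have cx := cF _ Ix; rewrite /prop_for /continuous_at patchE mem_set//.
    apply: cvg_trans cx; apply: near_eq_cvg.
    have : \forall y \near x, I01 y.
      by apply: open_nbhs_nbhs; split => //; exact: itv_open.
    by apply: filterS => y Iy; rewrite patchE mem_set.
move=> x y x0 xy y1; rewrite !E ?Fv//; apply/andP; split => //.
  exact: (le_trans xy).
exact: (le_trans x0).
Qed.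

Lemma weak01_ae u u' v v' : Rintegrable I01 u -> Rintegrable I01 u' ->
  Rintegrable I01 v -> Rintegrable I01 v' ->
  {ae mu, forall x, I01 x -> u x = u' x} ->
  {ae mu, forall x, I01 x -> v x = v' x} -> weak01 u v -> weak01 u' v'.
Proof.
move=> hu hu' hv hv' uu vv uv phi tphi.
have [dphi cphi _] := tphi.
have mphi' : measurable_fun I01 (derive1 phi).
  by apply: Rintegrable_mfun; apply: continuous_Rintegrable;
    exact: continuous_subspaceT.
have mphi : measurable_fun I01 phi.
  apply: Rintegrable_mfun; apply: continuous_Rintegrable.
  apply: continuous_subspaceT => x; apply: differentiable_continuous.
  exact/derivable1_diffP.
have := uv _ tphi.
rewrite (@Rintegral_ae_eq _ _ mI01 _ (fun x => u' x * derive1 phi x)).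
- rewrite (@Rintegral_ae_eq _ _ mI01 (fun x => v x * _) (fun x => v' x * phi x))//.
  + by apply: measurable_funM => //; exact: Rintegrable_mfun.
  + by apply: measurable_funM => //; exact: Rintegrable_mfun.
  + by apply: ae_lebesgueS vv => x h Ix; rewrite h.
- by apply: measurable_funM => //; exact: Rintegrable_mfun.
- by apply: measurable_funM => //; exact: Rintegrable_mfun.
- by apply: ae_lebesgueS uu => x h Ix; rewrite h.
Qed.

End primitive01_theory.

(** * Continuously differentiable functions on the closed unit interval *)

Section continuously_differentiable.
Context {R : realType}.
Local Notation mu := (@lebesgue_measure R).
Local Notation I01 := (`]0, 1[%classic : set R).
Implicit Types u v w f g F G : R -> R.

(** Projection onto [0, 1]. Composing with it extends a function continuous on [0, 1] to the whole
    line, so that two-sided calculus applies at the endpoints. *)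
Let clamp (x : R) : R := Num.min 1 (Num.max 0 x).

Let clamp01 x : 0 <= clamp x <= 1.
Proof. by rewrite /clamp le_min ge_min ler01 le_max !lexx. Qed.

Let clamp_id x : 0 <= x <= 1 -> clamp x = x.
Proof. by case/andP => x0 x1; rewrite /clamp max_r// min_r. Qed.

Let clamp_continuous : continuous clamp.
Proof.
move=> x; apply: (@continuous_min R R (fun=> 1) (fun x => Num.max 0 x)).
  exact: cvg_cst.
by apply: (@continuous_max R R (fun=> 0) id); [exact: cvg_cst|exact: cvg_id].
Qed.

Let comp_clamp_continuous v : {within `[(0:R), 1], continuous v} ->
  continuous (v \o clamp).
Proof.
move=> /subspace_continuousP cv x.
have Ax : `[0, 1]%classic (clamp x) by rewrite /= in_itv /= clamp01.
have := cv _ Ax.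
apply: cvg_comp => P /= hP.
have H : nbhs (x : R) (clamp @^-1` [set t | `[0, 1]%classic t -> P t]) :=
  clamp_continuous hP.
by apply: filterS H => y h; apply: h; rewrite /= in_itv /= clamp01.
Qed.

Lemma primitive01_is_derive F v : {within `[(0:R), 1], continuous v} ->
  primitive01 F v -> exists G : R -> R, forall x : R, 0 <= x <= 1 ->
    is_derive x (1 : R) G (v x) /\ G x = F x.
Proof.
move=> cv Fv.
have ct := comp_clamp_continuous cv.
(* Starting at -1, and integrating up to 2 below, leaves [0, 1] in the interior of the interval. *)
pose G0 (y : R) := \int[mu]_(t in `[-1, y]) (v \o clamp) t.
have iG : mu.-integrable `[-1, 2] (EFin \o (v \o clamp)).
  apply: continuous_compact_integrable; first exact: segment_compact.
  exact: continuous_subspaceT.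
exists (fun y => (F 0 - G0 0) + G0 y) => x /andP[x0 x1]; split.
  have [dG G'] : derivable G0 x 1 /\ derive1 G0 x = (v \o clamp) x.
    by apply: (@continuous_FTC1_closed _ _ (-1) x 2 _ iG); [lra|lra|exact: ct].
  have -> : v x = 0 + (v \o clamp) x by rewrite /= clamp_id ?add0r// x0.
  have h1 : is_derive x (1 : R) (fun=> F 0 - G0 0) 0 by exact: is_derive_cst.
  have h2 : is_derive x (1 : R) G0 ((v \o clamp) x).
    by apply: (DeriveDef dG); rewrite -G' derive1E.
  exact: is_deriveD.
have : G0 x - G0 0 = \int[mu]_(t in `[0, x]) v t.
  have i1 : mu.-integrable `[-1, x] (EFin \o (v \o clamp)).
    apply: (integrableS _ _ _ iG) => //.
    by move=> y /=; rewrite !in_itv /= => /andP[? ?]; apply/andP; split; lra.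
  rewrite /G0 Rintegral_itvB ?bnd_simp ?oppr_le0//.
  rewrite Rintegral_itv_obnd_cbnd//; last first.
    apply: (integrableS _ _ _ i1) => //.
    by move=> y /=; rewrite !in_itv /= => /andP[? ?]; apply/andP; split; lra.
  apply: eq_Rintegral => t; rewrite inE /= in_itv /= => /andP[t0 tx].
  by rewrite clamp_id// t0 (le_trans tx).
by rewrite -(Fv 0 x)// => /eqP; rewrite subr_eq => /eqP ->; ring.
Qed.

Lemma test_function_bnd (phi : R -> R) : test_function phi ->
  phi 0 = 0 /\ phi 1 = 0.
Proof.
case=> _ _ cphi.
have h x : ~ I01 x -> phi x = 0.
  move=> Ix; apply/eqP/negPn/negP => px; apply: Ix; apply: cphi.
  exact: subset_closure.
by split; apply: h; rewrite /= in_itv /= ?ltxx ?andbF.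
Qed.

Lemma primitive01_weak01 F v : {within `[(0:R), 1], continuous v} ->
  primitive01 F v -> weak01 F v.
Proof.
move=> cv Fv phi tphi; have [phi0 phi1] := test_function_bnd tphi.
have [dphi cphi _] := tphi.
have [G hG] := primitive01_is_derive cv Fv.
have cphi0 : continuous phi.
  move=> x; apply: differentiable_continuous; exact/derivable1_diffP.
have cG x : 0 <= x <= 1 -> {for x, continuous G}.
  move=> /hG[[dG _] _]; apply: differentiable_continuous.
  exact/derivable1_diffP.
have dG : derivable_oo_LRcontinuous G 0 1.
  split.
  - move=> x; rewrite in_itv /= => /andP[x0 x1].
    by have [|[]] := hG x; rewrite ?(ltW x0) ?(ltW x1).
  - by apply: cvg_at_right_filter; apply: cG; rewrite lexx /= ler01.
  - by apply: cvg_at_left_filter; apply: cG; rewrite lexx /= ler01.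
have dp : derivable_oo_LRcontinuous phi 0 1.
  split.
  - by move=> x _.
  - by apply: cvg_at_right_filter; exact: cphi0.
  - by apply: cvg_at_left_filter; exact: cphi0.
have G' : {in `]0, 1[, derive1 G =1 v}.
  move=> x; rewrite in_itv /= => /andP[x0 x1]; rewrite derive1E.
  by have [|[]] := hG x; rewrite ?(ltW x0) ?(ltW x1).
have cwphi : {within `[(0:R), 1], continuous (derive1 phi)}.
  exact: continuous_subspaceT.
have := Rintegration_by_parts (@ltr01 R) cv dG G' cwphi dp (fun x _ => erefl).
rewrite phi0 phi1 !mulr0 subrr sub0r.
have mv : measurable_fun I01 v by apply: Rintegrable_mfun; exact: continuous_Rintegrable.
have mG : measurable_fun I01 G.
  apply: Rintegrable_mfun; apply: continuous_Rintegrable.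
  exact: derivable_oo_LRcontinuous_within dG.
have mphi : measurable_fun I01 phi.
  apply: Rintegrable_mfun; apply: continuous_Rintegrable.
  exact: continuous_subspaceT.
have mphi' : measurable_fun I01 (derive1 phi).
  by apply: Rintegrable_mfun; apply: continuous_Rintegrable.
rewrite -!Rintegral_I01; [|exact: measurable_funM..].
move=> <-; apply: eq_Rintegral => x; rewrite inE /= in_itv /= => /andP[x0 x1].
by have [|_ ->] := hG x; rewrite ?(ltW x0) ?(ltW x1).
Qed.

(** The filter is that of [curve_x]: on [0, 1] the quotients of [F] are those of the extension,
    whose two-sided derivative is known. *)
Lemma primitive01_slope F v x : {within `[(0:R), 1], continuous v} ->
  primitive01 F v -> 0 <= x <= 1 ->
  (y - x)^-1 * (F y - F x) @[y --> within `[0, 1] x^'] --> v x.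
Proof.
move=> cv Fv x01; have [G hG] := primitive01_is_derive cv Fv.
have [[dG G'] Gx] := hG _ x01.
have : h^-1 *: (G (h *: 1 + x) - G x) @[h --> 0^'] --> v x.
  by rewrite -G'; exact: dG.
move=> /cvgrPdist_le cd; apply/cvgrPdist_le => e /cd /nbhs_ballP[d /= d0 hd].
apply/nbhs_ballP; exists d => // y xy yx Iy.
have yx0 : y - x != 0 by rewrite subr_eq0.
have := hd (y - x); rewrite /ball /= sub0r normrN distrC => /(_ xy yx0).
rewrite [_ *: 1]mulr1 subrK Gx.
by have [|_ ->] := hG y; first by move: Iy; rewrite /= in_itv.
Qed.

(** The integral of (f - s)^2 is nonnegative; the best choice of s is the mean slope (F y - F x) /
    (y - x). *)
Lemma primitive01_CauchySchwarz F f (x y : R) : sq01 f -> primitive01 F f ->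
  0 <= x -> x <= y -> y <= 1 ->
  (F y - F x) ^+ 2 <= (y - x) * \int[mu]_(t in I01) (f t ^+ 2).
Proof.
move=> sf Ff x0 xy y1.
have if1 : Rintegrable `[x, y] f by apply: Rintegrable_sub01 => //; exact: sq01_int.
have if2 : Rintegrable `[x, y] (fun t => f t ^+ 2).
  by apply: Rintegrable_sub01 => //; exact: sq01_sqr.
have ic c : Rintegrable `[x, y] (fun=> c).
  by apply: Rintegrable_sub01 => //; exact: Rintegrable_cst.
have sE : \int[mu]_(t in `[x, y]) (f t ^+ 2) <= \int[mu]_(t in I01) (f t ^+ 2).
  have pV := primitive01_int (sq01_sqr sf).
  rewrite -(pV x y)// Rintegral_I01; last by apply: Rintegrable_mfun; exact: sq01_sqr.
  have h1 := pV y 1 (le_trans x0 xy) y1 (lexx _).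
  have h0 := pV 0 x (lexx _) x0 (le_trans xy y1).
  rewrite set_itv1 Rintegral_set1 subr0 in h0.
  have p0 a b : 0 <= \int[mu]_(t in `[a, b]) (f t ^+ 2).
    by apply: Rintegral_ge0 => t _; exact: sqr_ge0.
  have := p0 y 1; have := p0 0 x; rewrite -h1; lra.
have key s : 0 <= \int[mu]_(t in `[x, y]) (f t ^+ 2)
    - 2 * s * (F y - F x) + s ^+ 2 * (y - x).
  rewrite (Ff x y)// -RintegralZl// -RintegralB//; last by exact: RintegrableZ.
  rewrite -Rintegral_itv_cst// -RintegralD//.
    apply: Rintegral_ge0 => t _; rewrite (_ : _ + _ = (f t - s) ^+ 2) ?sqr_ge0//.
    by ring.
    by apply: RintegrableB => //; exact: RintegrableZ.
  exact: ic.
have yx0 : 0 <= y - x by rewrite subr_ge0.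
apply: le_trans (ler_wpM2l yx0 sE).
have [yx|yx] := eqVneq (y - x) 0.
  move/eqP: yx; rewrite subr_eq0 => /eqP ->.
  by rewrite !subrr expr0n mul0r.
have yx1 : 0 < y - x by rewrite lt_def yx yx0.
have := key ((F y - F x) / (y - x)).
rewrite -(pmulr_rge0 _ yx1).
move=> h; rewrite -subr_ge0; congr (is_true (0 <= _)): h.
by field.
Qed.

End continuously_differentiable.

(** * Limits of weak derivatives *)

Section L2_limits.
Context {R : realType}.
Local Notation mu := (@lebesgue_measure R).
Local Notation I01 := (`]0, 1[%classic : set R).
Implicit Types (u v w f g : R -> R).
Local Notation E2 f := (\int[mu]_(x in I01) (f x ^+ 2)).

Lemma fatou_sq01 (f_ : nat -> R -> R) f (c : R) :
  (forall k, sq01 (f_ k)) -> measurable_fun I01 f ->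
  {ae mu, forall x, I01 x -> f_ ^~ x @ \oo --> f x} ->
  (forall k, E2 (f_ k) <= c) -> sq01 f /\ E2 f <= c.
Proof.
move=> sf mf ff fc.
pose h k x := ((f_ k x) ^+ 2)%:E.
have mh k : measurable_fun I01 (h k).
  by apply/measurable_EFinP; apply: measurable_funX; exact: sq01_mfun.
have h0 k x : I01 x -> (0 <= h k x)%E by move=> _; rewrite lee_fin sqr_ge0.
have int_h k : (\int[mu]_(x in I01) h k x <= c%:E)%E.
  rewrite /h -(fineK (integrable_fin_num mI01 (sq01_sqr (sf k)))) lee_fin.
  exact: fc.
have mlim : measurable_fun I01 (fun x => limn_einf (h ^~ x)).
  rewrite /limn_einf; apply: measurableT_comp => //.
  apply: (@measurable_fun_limn_esup _ _ _ _ (fun k x => - h k x)%E) => k.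
  exact: measurableT_comp.
have int_lim : (\int[mu]_(x in I01) (f x ^+ 2)%:E <= c%:E)%E.
  have := fatou mu mI01 mh h0.
  rewrite (@ae_eq_integral _ _ _ mu I01 (fun x => (f x ^+ 2)%:E)) //.
  - move=> /le_trans; apply; rewrite limn_einf_lim.
    apply: lime_le; first exact: is_cvg_einfs.
    apply: nearW => n; apply: le_trans (int_h n).
    by apply: ereal_inf_lbound; exists n => //=.
  - by apply/measurable_EFinP; exact: measurable_funX.
  - apply: ae_lebesgueS ff => x hx Ix.
    have hc : h ^~ x @ \oo --> ((f x) ^+ 2)%:E.
      apply: cvg_EFin; first exact: nearW.
      by rewrite expr2; apply: cvgM; exact: hx.
    by have [-> _] := cvg_limn_einf_sup hc.
have i2 : Rintegrable I01 (fun x => f x ^+ 2).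
  apply/integrableP; split.
    by apply/measurable_EFinP; exact: measurable_funX.
  under eq_integral do rewrite /= ger0_norm ?sqr_ge0//.
  by rewrite (le_lt_trans int_lim)// ltry.
split; first by apply/sq01P.
by rewrite -lee_fin fineK// integrable_fin_num.
Qed.

Lemma Rintegral_norm_le f (s : R) : sq01 f -> 0 < s -> E2 f <= s ^+ 2 ->
  \int[mu]_(x in I01) `|f x| <= 2 * s.
Proof.
move=> sf s0 fs.
have i1 := sq01_int sf; have i2 := sq01_sqr sf.
(* |f| <= s + f^2 / s replaces the Cauchy-Schwarz inequality, at the price of the factor 2. *)
apply: (@le_trans _ _ (\int[mu]_(x in I01) (s + s^-1 * f x ^+ 2))).
  apply: le_Rintegral => //.
  - exact: Rintegrable_norm.
  - apply: RintegrableD => //; first exact: Rintegrable_cst.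
    exact: RintegrableZ.
  - move=> x _; rewrite -subr_ge0 -(pmulr_rge0 _ s0).
    rewrite mulrBr mulrDr mulrA divff ?gt_eqF// mul1r -(real_normK (num_real (f x))).
    by have := sqr_ge0 (s - `|f x|); have := normr_ge0 (f x); nra.
rewrite RintegralD//; last 2 first.
- exact: Rintegrable_cst.
- exact: RintegrableZ.
rewrite Rintegral_I01_cst RintegralZl//.
have : s^-1 * E2 f <= s^-1 * s ^+ 2 by rewrite ler_wpM2l// invr_ge0 ltW.
by rewrite expr2 mulKf ?gt_eqF//; lra.
Qed.

Lemma geometric_half_sum (n : nat) :
  \sum_(0 <= k < n) (2^-1 : R) ^+ k <= 2.
Proof.
suff : \sum_(0 <= k < n) (2^-1 : R) ^+ k = 2 - 2 * 2^-1 ^+ n.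
  by move=> ->; rewrite gerBl mulr_ge0// exprn_ge0.
elim: n => [|n IH]; first by rewrite big_nil expr0 mulr1 subrr.
by rewrite big_nat_recr//= IH exprS; field.
Qed.

(** Completeness for a sequence with geometric rate: the increments have summable L^1 norms, so the
    telescoping series converges almost everywhere, and Fatou's lemma carries the rate to the
    limit. *)
Lemma L2_limit (u_ : nat -> R -> R) : (forall k, sq01 (u_ k)) ->
  (forall n k, (n <= k)%N ->
     E2 (fun x => u_ k x - u_ n x) <= (2^-1 ^+ n) ^+ 2) ->
  exists2 w, sq01 w & forall n, E2 (fun x => w x - u_ n x) <= (2^-1 ^+ n) ^+ 2.
Proof.
move=> su cu.
pose D k x : R := `|u_ k.+1 x - u_ k x|.
have h0 k : 0 < (2^-1 : R) ^+ k by rewrite exprn_gt0.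
have sD k : sq01 (fun x => u_ k.+1 x - u_ k x) by exact: sq01B.
have mD k : measurable_fun I01 (fun x => (D k x)%:E).
  by apply/measurable_EFinP; apply: measurableT_comp => //; exact: sq01_mfun.
have D0 k x : I01 x -> (0 <= (D k x)%:E)%E by move=> _; rewrite lee_fin normr_ge0.
have intD k : (\int[mu]_(x in I01) (D k x)%:E <= (2 * 2^-1 ^+ k)%:E)%E.
  rewrite -(fineK (integrable_fin_num mI01 (Rintegrable_norm (sq01_int (sD k))))).
  rewrite lee_fin; apply: Rintegral_norm_le => //.
  exact: cu.
have iS : mu.-integrable I01 (fun x => \sum_(k <oo) (D k x)%:E)%E.
  apply/integrableP; split.
    apply: (@ge0_emeasurable_sum _ _ _ I01 (fun k x => (D k x)%:E) xpredT) => //.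
    by move=> k x Ix _; exact: D0.
  under eq_integral => x Ix.
    rewrite gee0_abs; first over.
    by apply: nneseries_ge0 => k _ _; rewrite lee_fin normr_ge0.
  rewrite integral_nneseries//.
  apply: (@le_lt_trans _ _ 4%:E); last exact: ltry.
  apply: lime_le; first by apply: is_cvg_nneseries => k _ _; apply: integral_ge0 => x; exact: D0.
  apply: nearW => n.
  apply: (@le_trans _ _ (\sum_(0 <= k < n) (2 * 2^-1 ^+ k)%:E)%E).
    by apply: lee_sum => k _; exact: intD.
  rewrite sumEFin lee_fin -mulr_sumr.
  by have := geometric_half_sum n; lra.
have cvu : {ae mu, forall x, I01 x -> cvgn (u_ ^~ x)}.
  apply: ae_lebesgueS (integrable_ae mI01 iS) => x fx Ix.
  have {}fx := fx Ix.
  have cs : cvgn (series (telescope (u_ ^~ x))).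
    apply: normed_cvg; apply: nondecreasing_is_cvgn.
      by apply: nondecreasing_series => k _ _; exact: normr_ge0.
    exists (fine (\sum_(k <oo) (D k x)%:E)%E) => _ [n _ <-].
    rewrite -lee_fin fineK// /series /= -sumEFin.
    by apply: nneseries_lim_ge => k _ _; rewrite lee_fin normr_ge0.
  rewrite telescopeK in cs.
  have -> : u_ ^~ x = (fun n => (u_ n x - u_ 0%N x) + u_ 0%N x).
    by apply/funext => n; rewrite subrK.
  by apply: is_cvgD => //; exact: is_cvg_cst.
(* The upper limit is measurable everywhere, including on the null set where the sequence
   diverges. *)
pose w x := fine (limn_esup (fun k => (u_ k x)%:E)).
have mw : measurable_fun I01 w.
  apply: measurableT_comp => //.
  apply: measurable_fun_limn_esup => k.
  by apply/measurable_EFinP; exact: sq01_mfun.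
have cw : {ae mu, forall x, I01 x -> u_ ^~ x @ \oo --> w x}.
  apply: ae_lebesgueS cvu => x hx Ix.
  have {hx}/cvg_ex[l ul] := hx Ix.
  have ule : (fun k => (u_ k x)%:E) @ \oo --> l%:E by apply: cvg_EFin => //; exact: nearW.
  by rewrite /w; have [_ ->] := cvg_limn_einf_sup ule.
have key n : sq01 (fun x => w x - u_ n x) /\
    E2 (fun x => w x - u_ n x) <= (2^-1 ^+ n) ^+ 2.
  apply: (@fatou_sq01 (fun k x => u_ (k + n)%N x - u_ n x)).
  - by move=> k; exact: sq01B.
  - by apply: measurable_funB => //; exact: sq01_mfun.
  - apply: ae_lebesgueS cw => x hx Ix.
    apply: cvgB; last exact: cvg_cst.
    by rewrite (@cvg_shiftn n _ (u_ ^~ x)); exact: hx.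
  - by move=> k; apply: cu; exact: leq_addl.
exists w; last by move=> n; have [] := key n.
have [s0 _] := key 0%N.
by have := sq01D s0 (su 0%N); under eq_fun do rewrite subrK.
Qed.

End L2_limits.

(** * Elements of nearly minimal norm in convex sets *)

Section minimal_norm.
Context {R : realType}.
Local Notation mu := (@lebesgue_measure R).
Local Notation I01 := (`]0, 1[%classic : set R).
Implicit Types (u v w z f g : R -> R).
Local Notation E2 f := (\int[mu]_(x in I01) (f x ^+ 2)).

Lemma E2_ge0 f : 0 <= E2 f.
Proof. by apply: Rintegral_ge0 => x _; exact: sqr_ge0. Qed.

Lemma E2_parallelogram f g : sq01 f -> sq01 g ->
  E2 (fun x => f x - g x) =
  2 * E2 f + 2 * E2 g - 4 * E2 (fun x => 2^-1 * (f x + g x)).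
Proof.
move=> sf sg.
have i1 := sq01_sqr sf; have i2 := sq01_sqr sg.
have i3 := sq01_sqr (sq01Z 2^-1 (sq01D sf sg)).
rewrite -!RintegralZl// -RintegralD//; [|exact: RintegrableZ..].
rewrite -RintegralB//; [|by apply: RintegrableD => //; exact: RintegrableZ|exact: RintegrableZ].
by apply: eq_Rintegral => x _; field.
Qed.

(** Young's inequality. Used with s = 2^-n to bound the norm of a limit by that of its n-th
    approximation: the second term is then at most (1 + 1/s) s^2, which tends to 0. *)
Lemma E2_perturb f g (s : R) : sq01 f -> sq01 g -> 0 < s ->
  E2 f <= (1 + s) * E2 g + (1 + s^-1) * E2 (fun x => f x - g x).
Proof.
move=> sf sg s0.
have i1 := sq01_sqr sf; have i2 := sq01_sqr sg.
have i3 := sq01_sqr (sq01B sf sg).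
rewrite -!RintegralZl// -RintegralD//; [|exact: RintegrableZ..].
apply: le_Rintegral => //.
  by apply: RintegrableD => //; exact: RintegrableZ.
move=> x _; rewrite -subr_ge0.
rewrite (_ : _ - _ = s^-1 * (s * g x - (f x - g x)) ^+ 2).
  by rewrite mulr_ge0 ?sqr_ge0// invr_ge0 ltW.
by field; rewrite gt_eqF.
Qed.

(** The infima [d n] over the shrinking sets increase and stay below [C]. Once they are close to
    their supremum [ds], two elements of norm close to [ds] have a midpoint that cannot be much
    shorter, so they are close to each other. *)
Lemma minimal_norm_limit (K : nat -> set (R -> R)) (C : R) :
  (forall n u, K n u -> sq01 u) ->
  (forall n m, (n <= m)%N -> K m `<=` K n) ->
  (forall n u v, K n u -> K n v -> K n (fun x => 2^-1 * (u x + v x))) ->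
  (forall n, exists2 u, K n u & E2 u <= C + n.+1%:R^-1) ->
  exists u_ : nat -> R -> R, exists w,
    [/\ forall n, K n (u_ n), sq01 w, E2 w <= C &
        forall n, E2 (fun x => w x - u_ n x) <= (2^-1 ^+ n) ^+ 2].
Proof.
move=> Ksq Kd Kmid Kne.
pose S n := [set E2 u | u in K n].
pose d n := inf (S n).
have lbS n : has_lbound (S n) by exists 0 => _ [u _ <-]; exact: E2_ge0.
have neS n : S n !=set0 by have [u Ku _] := Kne n; exists (E2 u), u.
have dle n u : K n u -> d n <= E2 u.
  by move=> Ku; apply: ge_inf => //; exists u.
have d_mono n m : (n <= m)%N -> d n <= d m.
  move=> nm; apply: lb_le_inf => // _ [u Ku <-].
  by apply: dle; exact: Kd Ku.
have dC n : d n <= C.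
  apply/ler_addgt0Pr => e e0.
  near \oo => m.
  have nm : (n <= m)%N by near: m; exact: nbhs_infty_ge.
  have [u Ku uC] := Kne m.
  apply: (le_trans (d_mono _ _ nm)); apply: (le_trans (dle _ _ Ku)).
  apply: (le_trans uC); rewrite lerD2l.
  by near: m; exact: near_harmonic.
pose ds := sup (range d).
have ubd : has_ubound (range d) by exists C => _ [n _ <-].
have dds n : d n <= ds by apply: ub_le_sup => //; exists n.
have dsC : ds <= C by apply: ge_sup => [|_ [n _ <-]//]; exists (d 0%N), 0%N.
(* Two norms below ds + eta and a midpoint above ds - eta leave 2 eta + 2 eta + 4 eta in the
   parallelogram identity, hence the 8. *)
pose eta n : R := (2^-1 ^+ n) ^+ 2 / 8.
have eta0 n : 0 < eta n by rewrite divr_gt0// !exprn_gt0.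
have eta_mono n m : (n <= m)%N -> eta m <= eta n.
  move=> nm; rewrite ler_pM2r ?invr_gt0// lerXn2r ?nnegrE ?exprn_ge0//.
  by rewrite ler_wiXn2l// ?invf_le1// ?invr_ge0 ?ler1n.
have exN k : exists N : nat, (k <= N)%N /\ ds - eta k < d N.
  have hs : has_sup (range d) by split => //; exists (d 0%N), 0%N.
  have [_ [N _ <-] h] := sup_adherent (eta0 k) hs.
  exists (maxn k N); split; first exact: leq_maxl.
  by apply: (lt_le_trans h); apply: d_mono; exact: leq_maxr.
have exu k : exists u, exists N : nat,
    [/\ (k <= N)%N, ds - eta k < d N, K N u & E2 u < ds + eta k].
  have [N [kN dN]] := exN k.
  have hi : has_inf (S N) by split.
  have [_ [u Ku <-] h] := inf_adherent (eta0 k) hi.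
  by exists u, N; split => //; apply: (lt_le_trans h); rewrite lerD2r; exact: dds.
have [u_ hu] := choice exu.
have Ku n : K n (u_ n).
  by have [N [nN _ KN _]] := hu n; exact: Kd nN _ KN.
have cu n k : (n <= k)%N -> E2 (fun x => u_ k x - u_ n x) <= (2^-1 ^+ n) ^+ 2.
  move=> nk.
  have [N [nN dN KN En]] := hu n; have [M [kM dM KM Ek]] := hu k.
  have ekn := eta_mono _ _ nk.
  rewrite E2_parallelogram; [|exact: Ksq KM|exact: Ksq KN].
  pose m := minn N M.
  have dm : ds - eta n <= d m.
    rewrite /m; case: (leqP N M) => _; first exact: ltW.
    by apply: le_trans (ltW dM); rewrite lerD2l lerN2.
  have Km : K m (fun x => 2^-1 * (u_ k x + u_ n x)).
    by apply: Kmid; [apply: Kd KM; exact: geq_minr|apply: Kd KN; exact: geq_minl].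
  have := dle _ _ Km; rewrite (_ : (2^-1 ^+ n) ^+ 2 = 8 * eta n); last first.
    by rewrite /eta mulrC divfK.
  by lra.
have [w sw hw] := L2_limit (fun n => Ksq _ _ (Ku n)) cu.
exists u_, w; split => //.
apply/ler_addgt0Pr => e e0.
(* For s <= 1 the errors (1 + s) (C + s) + s^2 + s - C add up to at most s (|C| + 4). *)
pose M := `|C| + 5.
have M0 : 0 < M by rewrite ltr_wpDl.
have eM : 0 < e / M by rewrite divr_gt0.
near \oo => n.
pose s : R := 2^-1 ^+ n.
have s0 : 0 < s by rewrite exprn_gt0.
have s1 : s <= 1 by rewrite exprn_ile1// ?invr_ge0// invf_le1// ler1n.
have se : s * M <= e.
  rewrite -ler_pdivlMr//.
  rewrite /s; near: n.
  have h : `|2^-1 : R| < 1 by rewrite ger0_norm ?invr_ge0// invf_lt1// ltr1n.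
  have /cvgrPdist_le/(_ _ eM) := cvg_expr h.
  by apply: filterS => n; rewrite sub0r normrN ger0_norm ?exprn_ge0 ?invr_ge0.
have [N [nN dN KN En]] := hu n.
have := E2_perturb sw (Ksq _ _ (Ku n)) s0.
have h1 : (1 + s^-1) * E2 (fun x => w x - u_ n x) <= s ^+ 2 + s.
  apply: (@le_trans _ _ ((1 + s^-1) * s ^+ 2)).
    by rewrite ler_wpM2l ?hw// addr_ge0// invr_ge0 ltW.
  by rewrite mulrDl mul1r expr2 mulKf ?gt_eqF.
have h2 : (1 + s) * E2 (u_ n) <= (1 + s) * (C + s).
  rewrite ler_wpM2l ?addr_ge0 ?(ltW s0)//.
  apply: (le_trans (ltW En)); apply: lerD => //.
  have : eta n <= s ^+ 2 by rewrite /eta -/s ler_pdivrMr//; nra.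
  by nra.
have := ler_norm C; rewrite /M in se; nra.
Unshelve. all: by end_near. Qed.

Lemma continuous_bounded01 f : {within `[(0:R), 1], continuous f} ->
  exists2 M : R, 0 < M & forall x, I01 x -> `|f x| <= M.
Proof.
move=> cf.
have := continuous_compact cf (@segment_compact R 0 1).
move=> /compact_bounded[M [Mr HM]].
exists (`|M| + 1); first by rewrite ltr_wpDl.
move=> x Ix; apply: (HM (`|M| + 1)).
  by rewrite (le_lt_trans (ler_norm _))// ltrDl.
by exists x => //; exact: subset_itv_oo_cc Ix.
Qed.

Lemma test_function_bounded (phi : R -> R) : test_function phi ->
  exists2 M : R, 0 < M &
    forall x, I01 x -> `|phi x| <= M /\ `|derive1 phi x| <= M.
Proof.
move=> [dphi cphi _].
have cphi0 : {within `[(0:R), 1], continuous phi}.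
  apply: continuous_subspaceT => x; apply: differentiable_continuous.
  exact/derivable1_diffP.
have [M M0 h] := continuous_bounded01 cphi0.
have cphi1 : {within `[(0:R), 1], continuous (derive1 phi)}.
  exact: continuous_subspaceT.
have [N N0 h'] := continuous_bounded01 cphi1.
exists (Num.max M N); first by rewrite lt_max M0.
by move=> x Ix; rewrite !le_max h// h'// orbT.
Qed.

Lemma test_function_Rintegrable (phi f : R -> R) : test_function phi ->
  Rintegrable I01 f -> Rintegrable I01 (fun x => f x * phi x) /\
    Rintegrable I01 (fun x => f x * derive1 phi x).
Proof.
move=> tphi hf; have [M _ hM] := test_function_bounded tphi.
have [dphi cphi _] := tphi.
split; apply: (@Rintegrable_Mbounded _ _ _ M) => //.
- apply: Rintegrable_mfun; apply: continuous_Rintegrable.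
  apply: continuous_subspaceT => x; apply: differentiable_continuous.
  exact/derivable1_diffP.
- by move=> x /hM[].
- apply: Rintegrable_mfun; apply: continuous_Rintegrable.
  exact: continuous_subspaceT.
- by move=> x /hM[].
Qed.

Lemma weak01Z (a : R) u v : Rintegrable I01 u -> Rintegrable I01 v ->
  weak01 u v -> weak01 (fun x => a * u x) (fun x => a * v x).
Proof.
move=> hu hv uv phi tphi.
have [_ i2] := test_function_Rintegrable tphi hu.
have [i1 _] := test_function_Rintegrable tphi hv.
under eq_Rintegral do rewrite -mulrA.
under [in RHS]eq_Rintegral do rewrite -mulrA.
by rewrite !RintegralZl// uv// mulrN.
Qed.

Lemma weak01D u v u' v' : Rintegrable I01 u -> Rintegrable I01 v ->
  Rintegrable I01 u' -> Rintegrable I01 v' -> weak01 u v -> weak01 u' v' ->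
  weak01 (fun x => u x + u' x) (fun x => v x + v' x).
Proof.
move=> hu hv hu' hv' uv uv' phi tphi.
have [_ i2] := test_function_Rintegrable tphi hu.
have [i1 _] := test_function_Rintegrable tphi hv.
have [_ i2'] := test_function_Rintegrable tphi hu'.
have [i1' _] := test_function_Rintegrable tphi hv'.
under eq_Rintegral do rewrite mulrDl.
under [in RHS]eq_Rintegral do rewrite mulrDl.
by rewrite !RintegralD// uv// uv'// opprD.
Qed.

(* Banach-Saks in disguise: the derivatives [u] need not converge, but nearly
   norm-minimal elements of the convex sets they generate do. *)
Lemma weak01_closure v (C : R) : Rintegrable I01 v ->
  (forall e : R, 0 < e -> exists z, exists u,
     [/\ Rintegrable I01 z, sq01 u, weak01 z u, E2 u <= C + e &
         forall x, I01 x -> `|z x - v x| <= e]) ->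
  exists w, [/\ sq01 w, weak01 v w & E2 w <= C].
Proof.
move=> iv H.
(* The derivatives of functions close to [v]: convex because both the weak derivative and the
   uniform ball are. *)
pose K n := [set u | sq01 u /\ exists z, [/\ Rintegrable I01 z, weak01 z u &
  forall x, I01 x -> `|z x - v x| <= n.+1%:R^-1]].
have [|||n|u_ [w [Ku sw wC wu]]] := @minimal_norm_limit K C.
- by move=> n u [].
- move=> n m nm u [su [z [iz zu zv]]]; split => //; exists z; split => // x Ix.
  by apply: (le_trans (zv x Ix)); rewrite lef_pV2 ?posrE// ler_nat.
- move=> n u1 u2 [s1 [z1 [i1 w1 h1]]] [s2 [z2 [i2 w2 h2]]]; split.
    by apply: sq01Z; exact: sq01D.
  exists (fun x => 2^-1 * (z1 x + z2 x)); split.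
  + by apply: RintegrableZ => //; exact: RintegrableD.
  + apply: weak01Z; [exact: RintegrableD|by apply: RintegrableD; [exact: mI01|exact: sq01_int..]|].
    by apply: weak01D => //; exact: sq01_int.
  + move=> x Ix; have := h1 x Ix; have := h2 x Ix; rewrite !ler_norml.
    move: n.+1%:R^-1 => t.
    by move=> /andP[? ?] /andP[? ?]; apply/andP; split; lra.
- have [z [u [iz su zu uC zv]]] := H n.+1%:R^-1 (ltac:(by [])).
  by exists u => //; split => //; exists z.
exists w; split => // phi tphi; apply/eqP; rewrite -subr_eq0 opprK.
set A := _ + _.
have [M M0 hM] := test_function_bounded tphi.
(* The integration by parts being exact for [z] and [u_ n], the defect [A] is that of the
   differences: M / (n + 1) from v - z, and 2 M 2^-n <= 2 M / (n + 1) from w - u_n. *)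
have bound n : `|A| <= 3 * M * n.+1%:R^-1.
  have [su [z [iz zu zv]]] := Ku n.
  have iu := sq01_int su; have iw := sq01_int sw.
  have [i1 i2] := test_function_Rintegrable tphi (RintegrableB mI01 iv iz).
  have [i3 i4] := test_function_Rintegrable tphi (RintegrableB mI01 iw iu).
  have -> : A = \int[mu]_(x in I01) ((v x - z x) * derive1 phi x) +
      \int[mu]_(x in I01) ((w x - u_ n x) * phi x).
    under eq_Rintegral do rewrite mulrBl.
    under [X in _ = _ + X]eq_Rintegral do rewrite mulrBl.
    have [vi1 vi2] := test_function_Rintegrable tphi iv.
    have [zi1 zi2] := test_function_Rintegrable tphi iz.
    have [ui1 ui2] := test_function_Rintegrable tphi iu.
    have [wi1 wi2] := test_function_Rintegrable tphi iw.
    rewrite RintegralB// RintegralB//.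
    by have := zu _ tphi; rewrite /A => ->; ring.
  have iD : Rintegrable I01 (fun x => `|w x - u_ n x|).
    by apply: Rintegrable_norm; apply: RintegrableB.
  have h1 : `|\int[mu]_(x in I01) ((v x - z x) * derive1 phi x)| <= M * n.+1%:R^-1.
    apply: (le_trans (le_normr_Rintegral mI01 i2)).
    rewrite -[leRHS](Rintegral_I01_cst); apply: le_Rintegral => //.
    - exact: Rintegrable_norm.
    - exact: Rintegrable_cst.
    - move=> x Ix; rewrite normrM mulrC ler_pM//; first by have [] := hM x Ix.
      by rewrite distrC; exact: zv.
  have h2 : `|\int[mu]_(x in I01) ((w x - u_ n x) * phi x)| <= M * (2 * 2^-1 ^+ n).
    apply: (le_trans (le_normr_Rintegral mI01 i3)).
    apply: (@le_trans _ _ (\int[mu]_(x in I01) (M * `|w x - u_ n x|))).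
      apply: le_Rintegral => //; [exact: Rintegrable_norm|exact: RintegrableZ|].
      by move=> x Ix; rewrite normrM mulrC ler_wpM2r//; have [] := hM x Ix.
    rewrite RintegralZl// ler_wpM2l ?(ltW M0)//.
    by apply: Rintegral_norm_le; [exact: sq01B|rewrite exprn_gt0|exact: wu].
  apply: (le_trans (ler_normD _ _)); apply: (le_trans (lerD h1 h2)).
  have h3 : 2^-1 ^+ n <= n.+1%:R^-1 :> R.
    by rewrite exprVn lef_pV2 ?posrE ?exprn_gt0// -natrX ler_nat ltn_expl.
  rewrite (_ : 3 * M * _ = M * n.+1%:R^-1 + M * (2 * n.+1%:R^-1)); last by ring.
  by rewrite lerD2l ler_wpM2l ?(ltW M0)// ler_wpM2l.
rewrite -normr_eq0 eq_le normr_ge0 andbT.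
apply/ler_addgt0Pr => e e0; rewrite add0r.
have M3 : 0 < 3 * M by rewrite mulr_gt0.
near \oo => n; apply: (le_trans (bound n)).
rewrite mulrC -ler_pdivlMr//; near: n; apply: near_harmonic.
by rewrite divr_gt0.
Unshelve. all: by end_near. Qed.

End minimal_norm.

(** * Curves of class H^2 *)

Section curves.
Context {R : realType}.
Local Notation mu := (@lebesgue_measure R).
Local Notation I01 := (`]0, 1[%classic : set R).
Local Notation E2 f := (\int[mu]_(x in I01) (f x ^+ 2)).
Implicit Types g v w : R -> 'rV[R]_2.

Definition bending g : R := \int[mu]_(x in `[0, 1]) (enorm (curve_xx g x) ^+ 2).

Lemma dotE (a b : 'rV[R]_2) : dot a b = a 0 0 * b 0 0 + a 0 1 * b 0 1.
Proof. by rewrite /dot sum_ord2. Qed.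

Lemma enorm_sqr (a : 'rV[R]_2) : enorm a ^+ 2 = a 0 0 ^+ 2 + a 0 1 ^+ 2.
Proof.
by rewrite sqr_sqrtr dotE -!expr2// addr_ge0 ?sqr_ge0.
Qed.

Lemma enorm_ge0 (a : 'rV[R]_2) : 0 <= enorm a.
Proof. exact: sqrtr_ge0. Qed.

(** Properness makes the limit that defines [curve_x] unique. From any point of [0, 1] one can move
    by 1/4 towards the farther endpoint without leaving the interval. *)
Lemma punctured_proper (x : R) : 0 <= x <= 1 ->
  ProperFilter (within `[0, 1] x^').
Proof.
move=> /andP[x0 x1]; apply: Build_ProperFilter => /nbhs_ballP[d /= d0 hd].
pose t := Num.min (d / 2) 4^-1.
have t0 : 0 < t by rewrite lt_min divr_gt0//= invr_gt0.
have td : t < d.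
  by rewrite gt_min ltr_pdivrMr// ltr_pMr// ltr1n.
have t4 : t <= 4^-1 by rewrite ge_min lexx orbT.
have h (y : R) : `|x - y| = t -> 0 <= y <= 1 -> False.
  move=> yt y01; apply: (hd y); rewrite /ball /= ?yt//.
    by apply/eqP => yx; move: yt; rewrite yx subrr normr0 => /eqP; rewrite lt_eqF.
have [xs|xs] := leP x 2^-1.
- apply: (h (x + t)); first by rewrite opprD addrA subrr sub0r normrN gtr0_norm.
  by apply/andP; split; lra.
- apply: (h (x - t)); first by rewrite opprB addrC subrK gtr0_norm.
  by apply/andP; split; lra.
Qed.

Lemma cvg_row (T : Type) (F : set_system T) (FF : Filter F)
    (f : T -> 'rV[R]_2) (l : 'rV[R]_2) :
  (forall j, (fun t => f t 0 j) @ F --> l 0 j) -> f @ F --> l.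
Proof.
move=> h; apply/cvg_ballP => e e0.
have h0 : \forall t \near F, ball (l 0 0) e (f t 0 0) by exact: (cvg_ballP _ _).1 (h 0) e e0.
have h1 : \forall t \near F, ball (l 0 1) e (f t 0 1) by exact: (cvg_ballP _ _).1 (h 1) e e0.
apply: (filterS2 _ _ h0 h1) => t b0 b1; split => // i j; rewrite ord1.
by have [->|->] := ord2_cases j.
Qed.

Lemma curve_x_lim g (x : R) (l : 'rV[R]_2) : 0 <= x <= 1 ->
  (forall j, (y - x)^-1 * (g y 0 j - g x 0 j) @[y --> within `[0, 1] x^'] --> l 0 j) ->
  curve_x g x = l.
Proof.
move=> x01 h; have PF := punctured_proper x01.
rewrite /curve_x; apply: cvg_lim; first exact: norm_hausdorff.
apply: cvg_row => j.
by apply: cvg_trans (h j); apply: near_eq_cvg; apply: nearW => y; rewrite !mxE.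
Qed.

Lemma primitive01_congr (F G f f' : R -> R) :
  (forall x, 0 <= x <= 1 -> F x = G x) ->
  (forall x, 0 <= x <= 1 -> f x = f' x) -> primitive01 F f -> primitive01 G f'.
Proof.
move=> FG ff' Ff x y x0 xy y1.
rewrite -!FG ?x0 ?y1 ?(le_trans x0 xy) ?(le_trans xy y1)// Ff//.
apply: eq_Rintegral => t; rewrite inE /= in_itv /= => /andP[t0 t1].
by rewrite ff'// (le_trans x0 t0) (le_trans t1 y1).
Qed.

Lemma continuous01_congr (F G : R -> R) :
  (forall x, 0 <= x <= 1 -> F x = G x) ->
  {within `[(0:R), 1], continuous F} -> {within `[(0:R), 1], continuous G}.
Proof.
move=> FG; apply: subspace_eq_continuous => x.
by rewrite inE /= in_itv /= => /FG.
Qed.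

Lemma ae_congr01 (F G : R -> R) : (forall x, 0 <= x <= 1 -> F x = G x) ->
  {ae mu, forall x, I01 x -> F x = G x}.
Proof.
move=> FG; apply: aeW => x; rewrite /= in_itv /= => /andP[x0 x1].
by rewrite FG// !ltW.
Qed.

Lemma bendingE g : (forall j, sq01 (fun x => curve_xx g x 0 j)) ->
  bending g = \sum_(j < 2) E2 (fun x => curve_xx g x 0 j).
Proof.
move=> sw; rewrite sum_ord2 /bending.
have i0 := sq01_sqr (sw 0); have i1 := sq01_sqr (sw 1).
under eq_Rintegral do rewrite enorm_sqr.
rewrite -Rintegral_I01 ?RintegralD//.
by apply: Rintegrable_mfun; exact: RintegrableD.
Qed.

Lemma class_H2_weak g : class_H2 g ->
  [/\ forall j, {within `[(0:R), 1], continuous (fun x => g x 0 j)},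
      forall j, sq01 (fun x => curve_xx g x 0 j) &
      exists v, forall j, [/\ sq01 (fun x => v x 0 j),
        weak01 (fun x => g x 0 j) (fun x => v x 0 j) &
        weak01 (fun x => v x 0 j) (fun x => curve_xx g x 0 j)]].
Proof.
move=> [cg _ exw].
(* As a weak second derivative exists, [curve_xx] is one of them and not the default 0. *)
have [v [Lv Lw gv vw]] := xgetPex (fun=> 0) exw.
split.
- move=> j x.
  apply: (cvg_comp g (fun M : 'rV[R]_2 => M 0 j) (cg x)).
  exact: coord_continuous.
- exact: Lw.
- by exists v => j; split; [exact: Lv|move=> phi /gv|move=> phi /vw].
Qed.

(* [H^2] embeds into [C^1]. *)
Lemma class_H2_C1 g : class_H2 g -> forall j,
  [/\ {within `[(0:R), 1], continuous (fun x => curve_x g x 0 j)},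
      primitive01 (fun x => g x 0 j) (fun x => curve_x g x 0 j),
      sq01 (fun x => curve_xx g x 0 j),
      primitive01 (fun x => curve_x g x 0 j) (fun x => curve_xx g x 0 j) &
      weak01 (fun x => curve_x g x 0 j) (fun x => curve_xx g x 0 j)].
Proof.
move=> /class_H2_weak[cg Lw [v hv]].
have Fex j : exists F, [/\ primitive01 F (fun x => curve_xx g x 0 j),
    {within `[(0:R), 1], continuous F}, primitive01 (fun x => g x 0 j) F &
    weak01 F (fun x => curve_xx g x 0 j)].
  have [sv gv vw] := hv j.
  have iv := sq01_int sv; have iw := sq01_int (Lw j).
  have ig := continuous_Rintegrable (cg j).
  have [F Fw vF] := weak01_primitive iv iw vw.
  have cF := primitive01_continuous iw Fw.
  have iF := continuous_Rintegrable cF.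
  (* Being equal to [v] almost everywhere, the continuous [F] is also a weak derivative of the
     curve, hence its classical one. *)
  have vFae : {ae mu, forall x, I01 x -> v x 0 j = F x}.
    by apply: ae_lebesgueS (ae_lebesgue_pt iv) => x hx Ix; exact: vF.
  exists F; split => //.
  - apply: weak01_continuous_primitive => //.
    by apply: (weak01_ae _ _ _ _ _ vFae gv) => //; exact: aeW.
  - by apply: (weak01_ae _ _ _ _ vFae _ vw) => //; exact: aeW.
have [F hF] := choice Fex.
have cx x : 0 <= x <= 1 -> curve_x g x = \row_j F j x.
  move=> x01; apply: curve_x_lim => // j; rewrite mxE.
  by have [_ cF gF _] := hF j; exact: primitive01_slope cF gF x01.
move=> j; have [Fw cF gF Fww] := hF j.
have E x : 0 <= x <= 1 -> F j x = curve_x g x 0 j by move=> /cx ->; rewrite mxE.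
have cc := continuous01_congr E cF.
split => //.
- exact: primitive01_congr gF.
- exact: primitive01_congr Fw.
- have iw := sq01_int (Lw j).
  apply: (weak01_ae _ _ _ _ (ae_congr01 E) _ Fww) => //; try exact: aeW.
    exact: continuous_Rintegrable.
  exact: continuous_Rintegrable.
Qed.

Lemma continuous01_sq (f : R -> R) :
  {within `[(0:R), 1], continuous f} -> sq01 f.
Proof.
move=> cf; have [M _ hM] := continuous_bounded01 cf.
apply: (@sq01_bounded _ _ M) => //.
by apply: Rintegrable_mfun; exact: continuous_Rintegrable.
Qed.

(** Builds curves from their derivatives. The bending can be computed with any weak second
    derivative: [w] and the chosen [curve_xx] have the same primitive [v], so they agree almost
    everywhere. *)
Lemma class_H2_intro g v w :
  (forall j, {within `[(0:R), 1], continuous (fun x => v x 0 j)}) ->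
  (forall j, primitive01 (fun x => g x 0 j) (fun x => v x 0 j)) ->
  (forall j, sq01 (fun x => w x 0 j)) ->
  (forall j, weak01 (fun x => v x 0 j) (fun x => w x 0 j)) ->
  [/\ class_H2 g, forall x, 0 <= x <= 1 -> curve_x g x = v x &
      bending g = \sum_(j < 2) E2 (fun x => w x 0 j)].
Proof.
move=> cv gv sw vw.
have cx x : 0 <= x <= 1 -> curve_x g x = v x.
  by move=> x01; apply: curve_x_lim => // j; exact: (primitive01_slope (cv j) (gv j) x01).
have cg j : {within `[(0:R), 1], continuous (fun x => g x 0 j)}.
  by apply: primitive01_continuous (gv j); exact: continuous_Rintegrable.
have H2 : class_H2 g.
  split.
  - by move=> x; apply: cvg_row => j; exact: cg.
  - by move=> j; exact: continuous01_sq.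
  - exists w, v; split => //.
    + by move=> j; exact: continuous01_sq.
    + by move=> phi tphi j; exact: (primitive01_weak01 (cv j) (gv j) tphi).
    + by move=> phi tphi j; exact: vw.
split => //.
rewrite bendingE; last by move=> j; have [] := class_H2_C1 H2 j.
apply: eq_bigr => j _.
have [c1 c2 c3 c4 c5] := class_H2_C1 H2 j.
have E x : 0 <= x <= 1 -> curve_x g x 0 j = v x 0 j by move=> /cx ->.
have c4' : primitive01 (fun x => v x 0 j) (fun x => curve_xx g x 0 j).
  exact: primitive01_congr c4.
have c6 : primitive01 (fun x => v x 0 j) (fun x => w x 0 j).
  by apply: weak01_continuous_primitive => //; exact: sq01_int.
have := primitive01_inj (sq01_int c3) (sq01_int (sw j)) c4' c6.
move=> ae; apply: Rintegral_ae_eq => //.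
- by apply: measurable_funX; exact: sq01_mfun.
- by apply: measurable_funX; exact: sq01_mfun.
- by apply: ae_lebesgueS ae => x h Ix; rewrite h.
Qed.

Lemma bending_ge0 g : 0 <= bending g.
Proof. by apply: Rintegral_ge0 => x _; exact: sqr_ge0. Qed.

Lemma curve_x_holder g (x y : R) : class_H2 g -> 0 <= x -> x <= y -> y <= 1 ->
  enorm (curve_x g y - curve_x g x) ^+ 2 <= (y - x) * bending g.
Proof.
move=> Hg x0 xy y1; have C := class_H2_C1 Hg.
rewrite bendingE; last by move=> j; have [] := C j.
rewrite enorm_sqr !mxE sum_ord2 mulrDr.
have [_ _ s0 p0 _] := C 0; have [_ _ s1 p1 _] := C 1.
have h0 := primitive01_CauchySchwarz s0 p0 x0 xy y1.
have h1 := primitive01_CauchySchwarz s1 p1 x0 xy y1.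
exact: lerD.
Qed.

Lemma length_cst g (L : R) :
  (forall x, 0 <= x <= 1 -> enorm (curve_x g x) = L) ->
  length g = L /\ constant_speed g.
Proof.
move=> h; suff e : length g = L.
  by split => // x; rewrite in_itv /= => /h ->.
rewrite /length; transitivity (\int[mu]_(x in `[0, 1]) L).
  by apply: eq_Rintegral => x; rewrite inE /= in_itv /= => /h.
by rewrite Rintegral_itv_cst// subr0 mulr1.
Qed.

End curves.

(** * Compactness of curves along an ultrafilter *)

Section weak_limits.
Context {R : realType}.
Local Notation mu := (@lebesgue_measure R).
Local Notation I01 := (`]0, 1[%classic : set R).
Local Notation E2 f := (\int[mu]_(x in I01) (f x ^+ 2)).

(** The image lives in a compact segment, so it has a cluster point, and an ultrafilter converges to
    its cluster points. *)
Lemma ultra_cvg (T : Type) (U : set_system T) (s : T -> R) (B : R) :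
  UltraFilter U -> (forall t, `|s t| <= B) -> exists l : R, s @ U --> l.
Proof.
move=> UU sB.
have PU : ProperFilter (s @ U) by exact: fmap_proper_filter.
have sK : (s @ U) `[- B, B]%classic.
  by apply: nearW => t; rewrite /= in_itv /= -ler_norml.
have [p [_ cp]] := @segment_compact R (- B) B _ PU sK.
exists p => A Ap.
have [//|nA] := in_ultra_setVsetC (s @^-1` A) UU.
have [y [ny Ay]] := cp (~` A) A nA Ap.
by case: ny.
Qed.

Lemma near_all_ltn (T : Type) (F : set_system T) (FF : Filter F)
    (P : nat -> T -> Prop) (N : nat) :
  (forall k, \forall t \near F, P k t) ->
  \forall t \near F, forall k, (k < N)%N -> P k t.
Proof.
move=> h; elim: N => [|N IH]; first by apply: nearW.
apply: filterS2 (h N) IH => t hN hk k.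
by rewrite ltnS leq_eqVlt => /predU1P[->|/hk].
Qed.

Section scalar.
Variables (T : Type) (F : set_system T).
Context {FF : ProperFilter F}.
Variables (z_ u_ : T -> R -> R) (v : R -> R) (B : R).
Hypothesis su : forall t, sq01 (u_ t).
Hypothesis zu : forall t, primitive01 (z_ t) (u_ t).
Hypothesis uB : forall t, E2 (u_ t) <= B.
Hypothesis zv : forall x, 0 <= x <= 1 -> z_ ^~ x @ F --> v x.

Let B0 : 0 <= B.
Proof.
have [t _] := @filter_ex _ F _ setT filterT.
exact: le_trans (E2_ge0 _) (uB t).
Qed.

(** The Hölder constant does not depend on [t]; the estimate is closed, so [v] inherits it below. *)
Let z_holder t x y : 0 <= x <= 1 -> 0 <= y <= 1 ->
  (z_ t y - z_ t x) ^+ 2 <= `|y - x| * B.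
Proof.
wlog xy : x y / x <= y.
  move=> H x01 y01; have [xy|/ltW yx] := leP x y; first exact: H.
  by rewrite -sqrrN opprB distrC; exact: H.
move=> /andP[x0 _] /andP[_ y1].
apply: (le_trans (primitive01_CauchySchwarz (su t) (zu t) x0 xy y1)).
by rewrite ger0_norm ?subr_ge0// ler_wpM2l ?subr_ge0.
Qed.

Let v_holder x y : 0 <= x <= 1 -> 0 <= y <= 1 ->
  (v y - v x) ^+ 2 <= `|y - x| * B.
Proof.
move=> x01 y01.
have c : (fun t => (z_ t y - z_ t x) ^+ 2) @ F --> (v y - v x) ^+ 2.
  rewrite expr2; under eq_fun do rewrite expr2.
  by apply: cvgM; (apply: cvgB; exact: zv).
apply: (cvgr_to_le c).
by apply: nearW => t; exact: z_holder.
Qed.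

Lemma holder_limit_continuous : {within `[(0:R), 1], continuous v}.
Proof.
apply/subspace_continuousP => x; rewrite /= in_itv /= => x01.
apply/cvgrPdist_le => e e0.
have eB : 0 < e ^+ 2 / (B + 1) by rewrite divr_gt0 ?exprn_gt0// ltr_wpDl.
apply/nbhs_ballP; exists (e ^+ 2 / (B + 1)) => // y /= xy.
rewrite in_itv /= => y01.
rewrite -(ler_pXn2r (ltn0Sn 1)) ?nnegrE// ?(ltW e0)// real_normK ?num_real//.
apply: (le_trans (v_holder y01 x01)).
move: xy; rewrite /ball /= ltr_pdivlMr ?ltr_wpDl// => h.
by have := normr_ge0 (x - y); nra.
Qed.

(** A filter handles finitely many points at once, so pointwise convergence is used on a grid only;
    the Hölder bounds for [z_ t] and [v] cover the gaps. Each of the three errors is at most e /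
    3. *)
Lemma holder_limit_uniform (e : R) : 0 < e ->
  \forall t \near F, forall x, 0 <= x <= 1 -> `|z_ t x - v x| <= e.
Proof.
move=> e0; pose d := e / 3.
have d0 : 0 < d by rewrite divr_gt0.
(* [B + 1] instead of [B], which may be 0. *)
have dB : 0 < d ^+ 2 / (B + 1) by rewrite divr_gt0 ?exprn_gt0// ltr_wpDl.
near \oo => N.
have hN : N.+1%:R^-1 <= d ^+ 2 / (B + 1).
  by near: N; exact: near_harmonic.
(* Truncation at 1 keeps every [p k] in [0, 1], so convergence holds for all [k]; only the grid
   points 0, ..., N + 1 are used. *)
pose p k : R := Num.min 1 (k%:R / N.+1%:R).
have p01 k : 0 <= p k <= 1 by rewrite /p le_min ge_min ler01 lexx divr_ge0.
have : \forall t \near F, forall k, (k < N.+2)%N -> `|z_ t (p k) - v (p k)| <= d.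
  apply: near_all_ltn => k.
  have /cvgrPdist_le/(_ _ d0) := zv (p01 k).
  by apply: filterS => t; rewrite distrC.
apply: filterS => t ht x /andP[x0 x1].
have xN : 0 <= x * N.+1%:R by rewrite mulr_ge0.
have /andP[k1 k2] := truncn_itv xN.
set k := Num.truncn _ in k1 k2.
have kN : (k < N.+2)%N.
  rewrite ltnS -(ler_nat R); apply: (le_trans k1).
  by rewrite ler_piMl.
have pk : p k = k%:R / N.+1%:R.
  by rewrite /p min_r// ler_pdivrMr// mul1r ler_nat -ltnS.
have px : `|x - p k| <= N.+1%:R^-1.
  rewrite pk ger0_norm; last by rewrite subr_ge0 ler_pdivrMr.
  rewrite lerBlDr (_ : _ + _ = k.+1%:R / N.+1%:R).
    by rewrite ler_pdivlMr// ltW.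
  by rewrite -[in RHS]natr1 mulrDl mul1r addrC.
have small (a : R) : a ^+ 2 <= `|x - p k| * B -> `|a| <= d.
  move=> h; rewrite -(ler_pXn2r (ltn0Sn 1)) ?nnegrE// ?(ltW d0)// real_normK ?num_real//.
  apply: (le_trans h); apply: (@le_trans _ _ (d ^+ 2 / (B + 1) * B)).
    by rewrite ler_wpM2r// (le_trans px).
  rewrite -mulrA ler_piMr ?sqr_ge0// mulrC ler_pdivrMr ?ltr_wpDl// mul1r.
  by rewrite lerDl.
have x01 : 0 <= x <= 1 by rewrite x0.
have h1 := small _ (z_holder t (p01 k) x01).
have h2 := small _ (v_holder (p01 k) x01).
have h3 := ht k kN.
move: h1 h2 h3; rewrite !ler_norml /d => /andP[? ?] /andP[? ?] /andP[? ?].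
by apply/andP; split; lra.
Unshelve. all: by end_near. Qed.

Lemma weak_limit (e : R) : (forall t, weak01 (z_ t) (u_ t)) ->
  (fun t => E2 (u_ t)) @ F --> e ->
  exists w, [/\ sq01 w, weak01 v w & E2 w <= e].
Proof.
move=> wzu ce; apply: weak01_closure.
  exact: continuous_Rintegrable holder_limit_continuous.
move=> eps eps0.
have /cvgrPdist_le/(_ _ eps0) ce' := ce.
have [t [h1 h2]] := filter_ex (filterI (holder_limit_uniform eps0) ce').
exists (z_ t), (u_ t); split => //.
- apply: continuous_Rintegrable; apply: primitive01_continuous (zu t).
  exact: sq01_int.
- by move: h2; rewrite ler_norml => /andP[? ?]; lra.
- by move=> x; rewrite /= in_itv /= => /andP[x0 x1]; apply: h1; rewrite !ltW.
Qed.

Lemma holder_limit_integral (G_ : T -> R -> R) :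
  (forall t, primitive01 (G_ t) (z_ t)) ->
  (fun t => G_ t 1 - G_ t 0) @ F --> \int[mu]_(x in `[0, 1]) v x.
Proof.
move=> Gz; apply/cvgrPdist_le => e e0.
have := holder_limit_uniform e0; apply: filterS => t ht.
rewrite (Gz t 0 1)//.
have iz : Rintegrable `[0, 1] (z_ t).
  apply: Rintegrable_cc; apply: continuous_Rintegrable.
  by apply: primitive01_continuous (zu t); exact: sq01_int.
have iv : Rintegrable `[0, 1] v.
  by apply: Rintegrable_cc; apply: continuous_Rintegrable; exact: holder_limit_continuous.
have m1 : measurable (`[0, 1]%classic : set (measurableTypeR R)) by [].
rewrite -RintegralB//.
apply: (le_trans (le_normr_Rintegral m1 (RintegrableB m1 iv iz))).
apply: (@le_trans _ _ (\int[mu]_(x in `[0, 1]) e)).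
  apply: le_Rintegral => //.
  - by apply: Rintegrable_norm; exact: RintegrableB.
  - by apply: Rintegrable_cc; exact: Rintegrable_cst.
  - by move=> x; rewrite /= in_itv /= => x01; rewrite distrC ht.
by rewrite Rintegral_itv_cst// subr0 mulr1.
Qed.

End scalar.

(** Positions are not bounded, so only chords converge and the limit starts at the origin. Constant
    speed makes lengths converge, being norms of velocities; the bending is merely lower
    semicontinuous. *)
Lemma curve_limit (T : Type) (U : set_system T) (g_ : T -> R -> 'rV[R]_2) (B : R) :
  UltraFilter U -> (forall t, class_H2 (g_ t)) -> (forall t, constant_speed (g_ t)) ->
  (forall t, length (g_ t) <= B) -> (forall t, bending (g_ t) <= B) ->
  exists g,
  [/\ [/\ class_H2 g, constant_speed g & g 0 = 0],
      (fun t => length (g_ t)) @ U --> length g,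
      forall j, (fun t => g_ t 1 0 j - g_ t 0 0 j) @ U --> g 1 0 j,
      forall x, 0 <= x <= 1 -> forall j,
        (fun t => curve_x (g_ t) x 0 j) @ U --> curve_x g x 0 j &
      forall e : R, (fun t => bending (g_ t)) @ U --> e -> bending g <= e].
Proof.
move=> UU H2 cs lB bB.
have PU := @ultra_proper _ _ UU.
have C t := class_H2_C1 (H2 t).
have sp t x : 0 <= x <= 1 -> enorm (curve_x (g_ t) x) = length (g_ t).
  by move=> x01; apply: cs; rewrite in_itv.
have e0 : 0 <= (0 : R) <= 1 by rewrite lexx ler01.
have l0 t : 0 <= length (g_ t) by rewrite -(sp t 0)// enorm_ge0.
have sp2 t x : 0 <= x <= 1 ->
    curve_x (g_ t) x 0 0 ^+ 2 + curve_x (g_ t) x 0 1 ^+ 2 = length (g_ t) ^+ 2.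
  by move=> x01; rewrite -enorm_sqr sp.
have cB t x (j : 'I_2) : 0 <= x <= 1 -> `|curve_x (g_ t) x 0 j| <= B.
  move=> x01; rewrite (le_trans _ (lB t))//.
  rewrite -(ler_pXn2r (ltn0Sn 1)) ?nnegrE ?l0// real_normK ?num_real//.
  rewrite -(sp2 t x)//.
  have [->|->] := ord2_cases j.
  - by rewrite lerDl sqr_ge0.
  - by rewrite lerDr sqr_ge0.
(* Abscissa and coordinate are paired so that a single choice yields all limits; outside [0, 1] the
   value is a dummy. *)
have vex (q : R * 'I_2) : exists l : R, 0 <= q.1 <= 1 ->
    (fun t => curve_x (g_ t) q.1 0 q.2) @ U --> l.
  have [x01|nx] := boolP (0 <= q.1 <= 1); last by exists 0.
  have [l hl] := ultra_cvg UU (fun t => cB t q.1 q.2 x01).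
  by exists l.
have [V hV] := choice vex.
pose v x := \row_j V (x, j) : 'rV[R]_2.
have cv (j : 'I_2) x : 0 <= x <= 1 -> (fun t => curve_x (g_ t) x 0 j) @ U --> v x 0 j.
  by move=> x01; rewrite mxE; exact: (hV (x, j)).
have bE t : bending (g_ t) = \sum_(j < 2) E2 (fun x => curve_xx (g_ t) x 0 j).
  by rewrite bendingE// => j; have [] := C t j.
have EB t (j : 'I_2) : E2 (fun x => curve_xx (g_ t) x 0 j) <= B.
  rewrite (le_trans _ (bB t))// bE (bigD1 j)//= lerDl.
  by apply: sumr_ge0 => i _; exact: E2_ge0.
have eex (j : 'I_2) : exists e : R, (fun t => E2 (fun x => curve_xx (g_ t) x 0 j)) @ U --> e.
  by apply: (@ultra_cvg _ _ _ B) => // t; rewrite ger0_norm ?E2_ge0.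
have [e he] := choice eex.
have wex (j : 'I_2) : exists w, [/\ sq01 w, weak01 (fun x => v x 0 j) w & E2 w <= e j].
  apply: (@weak_limit _ U _ (fun t x => curve_x (g_ t) x 0 j)
    (fun t x => curve_xx (g_ t) x 0 j) _ B) => //.
  - by move=> t; have [] := C t j.
  - by move=> t; have [] := C t j.
  - exact: cv.
  - by move=> t; have [] := C t j.
have [W hW] := choice wex.
pose w x := \row_j W j x : 'rV[R]_2.
pose g x := \row_j (\int[mu]_(t in `[0, x]) v t 0 j) : 'rV[R]_2.
have vc (j : 'I_2) : {within `[(0:R), 1], continuous (fun x => v x 0 j)}.
  apply: (@holder_limit_continuous _ U _ (fun t x => curve_x (g_ t) x 0 j)
    (fun t x => curve_xx (g_ t) x 0 j) _ B) => //.
  - by move=> t; have [] := C t j.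
  - by move=> t; have [] := C t j.
  - exact: cv.
have gv (j : 'I_2) : primitive01 (fun x => g x 0 j) (fun x => v x 0 j).
  have := primitive01_int (continuous_Rintegrable (vc j)).
  by apply: primitive01_congr => // x _; rewrite mxE.
have wE (j : 'I_2) : (fun x => w x 0 j) = W j by apply/funext => x; rewrite mxE.
have [] := @class_H2_intro _ g v w vc gv.
- by move=> j; rewrite wE; have [] := hW j.
- by move=> j; rewrite wE; have [] := hW j.
move=> Hg gx gb.
have [l hl] := ultra_cvg UU (fun t => (ltac:(by rewrite ger0_norm) : `|length (g_ t)| <= B)).
have ll0 : 0 <= l.
  by apply: (cvgr_to_ge hl); apply: nearW.
(* The squared lengths have two limits, one through the coordinates of the velocity at [x] and one
   through [l], which does not depend on [x]. *)
have vl x : 0 <= x <= 1 -> enorm (curve_x g x) = l.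
  move=> x01; apply/eqP; rewrite -(eqrXn2 (ltn0Sn 1)) ?enorm_ge0//; apply/eqP.
  rewrite enorm_sqr gx//.
  have c1 : (fun t => length (g_ t) ^+ 2) @ U --> v x 0 0 ^+ 2 + v x 0 1 ^+ 2.
    under eq_fun do rewrite -(sp2 _ x x01).
    rewrite !expr2; under eq_fun do rewrite !expr2.
    by apply: cvgD; apply: cvgM; exact: cv.
  have c2 : (fun t => length (g_ t) ^+ 2) @ U --> l ^+ 2.
    by rewrite expr2; under eq_fun do rewrite expr2; exact: cvgM.
  exact: (cvg_unique _ c1 c2).
have [gl gcs] := length_cst vl.
exists g; split => //.
- split => //; apply/rowP => j; rewrite !mxE.
  by rewrite set_itv1 Rintegral_set1.
- by rewrite gl.
- move=> j; rewrite mxE.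
  apply: (@holder_limit_integral _ U _ (fun t x => curve_x (g_ t) x 0 j)
    (fun t x => curve_xx (g_ t) x 0 j) (fun x => v x 0 j) B _ _ _ _
    (fun t x => g_ t x 0 j)) => //.
  - by move=> t; have [] := C t j.
  - by move=> t; have [] := C t j.
  - exact: cv.
  - by move=> t; have [] := C t j.
- by move=> x x01 j; rewrite gx//; exact: cv.
- move=> b hb.
  have cb : (fun t => bending (g_ t)) @ U --> e 0 + e 1.
    under eq_fun do rewrite bE sum_ord2.
    by apply: cvgD; exact: he.
  have -> : b = e 0 + e 1 by exact: (cvg_unique _ hb cb).
  rewrite gb sum_ord2.
  have [_ _ h0] := hW 0; have [_ _ h1] := hW 1.
  rewrite -!wE in h0 h1.
  exact: lerD.
Qed.

End weak_limits.

(** * Plane geometry *)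

Section plane_geometry.
Context {R : realType}.
Implicit Types a b c d : 'rV[R]_2.

Lemma rV2P a b : a 0 0 = b 0 0 -> a 0 1 = b 0 1 -> a = b.
Proof.
move=> h0 h1; apply/rowP => j.
by have [->|->] := ord2_cases j.
Qed.

Lemma enorm1P a : enorm a = 1 <-> a 0 0 ^+ 2 + a 0 1 ^+ 2 = 1.
Proof.
rewrite -enorm_sqr; split => [->|h]; first by rewrite expr1n.
by apply/eqP; rewrite -(eqrXn2 (ltn0Sn 1)) ?enorm_ge0// h expr1n.
Qed.

Lemma enorm_sqrB a b :
  enorm (a - b) ^+ 2 = (a 0 0 - b 0 0) ^+ 2 + (a 0 1 - b 0 1) ^+ 2.
Proof. by rewrite enorm_sqr !mxE. Qed.

Lemma enorm_sqr_le0 a : enorm a ^+ 2 <= 0 -> a = 0.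
Proof.
rewrite enorm_sqr => h.
have : a 0 0 ^+ 2 + a 0 1 ^+ 2 == 0 by rewrite eq_le h addr_ge0 ?sqr_ge0.
rewrite paddr_eq0 ?sqr_ge0// !sqrf_eq0 => /andP[/eqP h0 /eqP h1].
by apply: rV2P; rewrite mxE.
Qed.

Lemma enormZ (t : R) a : 0 <= t -> enorm (t *: a) = t * enorm a.
Proof.
move=> t0; apply/eqP; rewrite -(eqrXn2 (ltn0Sn 1)) ?mulr_ge0 ?enorm_ge0//.
by rewrite exprMn !enorm_sqr !mxE; apply/eqP; ring.
Qed.

(** 1 = |c|^2 = |a + b|^2 = 2 + 2 (a . b). *)
Lemma dot_unit_sum0 a b c : enorm a = 1 -> enorm b = 1 -> enorm c = 1 ->
  a + b + c = 0 -> dot a b = - 2^-1.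
Proof.
move=> /enorm1P ha /enorm1P hb /enorm1P hc /rowP h.
have := h 0; have := h 1; rewrite !mxE dotE => h1 h0.
have e0 : c 0 0 = - (a 0 0 + b 0 0) by lra.
have e1 : c 0 1 = - (a 0 1 + b 0 1) by lra.
by rewrite e0 e1 in hc; lra.
Qed.

Lemma enorm_unitD a b : enorm a = 1 -> enorm b = 1 -> dot a b = - 2^-1 ->
  enorm (a + b) = 1.
Proof.
by rewrite dotE => /enorm1P ha /enorm1P hb h; apply/enorm1P; rewrite !mxE; lra.
Qed.

(** With x = cos(pi / 3) > 0, the triple angle formula for cos(pi) = -1 reads (x + 1) (2 x - 1)^2 =
    0. *)
Lemma cos_2pi3 : cos (2 * pi / 3) = - 2^-1 :> R.
Proof.
pose t : R := pi / 3; pose x := cos t.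
have pi0 := @pi_gt0 R.
have x0 : 0 < x by apply: cos_gt0_pihalf; rewrite /t; apply/andP; split; lra.
have c2 : cos (t + t) = 2 * x ^+ 2 - 1.
  by rewrite cosD -!expr2 sin2cos2; rewrite -/x; ring.
have s2 : sin (t + t) = 2 * x * sin t by rewrite sinD -/x; ring.
have : cos (t + t + t) = -1.
  by rewrite (_ : t + t + t = pi) ?cospi// /t; field.
rewrite cosD c2 s2 -/x => h.
have s22 : sin t * sin t = 1 - x ^+ 2 by rewrite -expr2 sin2cos2.
have {h} : (x + 1) * (2 * x - 1) ^+ 2 = 0.
  have : (2 * x ^+ 2 - 1) * x - 2 * x * (sin t * sin t) = -1 by rewrite -[RHS]h; ring.
  by rewrite s22 => h'; lra.
move=> /eqP; rewrite mulf_eq0 expf_eq0 /= => /orP[/eqP h|/eqP h]; first by lra.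
rewrite (_ : 2 * pi / 3 = t + t); last by rewrite /t; field.
have xE : x = 2^-1 by lra.
by rewrite c2 xE; field.
Qed.

Lemma angle_unit a b : enorm a = 1 -> enorm b = 1 ->
  angle a b = 2 * pi / 3 <-> dot a b = - 2^-1.
Proof.
move=> ha hb; rewrite /angle ha hb mulr1 divr1.
have pi0 := @pi_gt0 R.
split => h.
  rewrite -cos_2pi3 -h acosK//.
  move: ha hb => /enorm1P ha /enorm1P hb.
  have := sqr_ge0 (a 0 0 - b 0 0); have := sqr_ge0 (a 0 1 - b 0 1).
  have := sqr_ge0 (a 0 0 + b 0 0); have := sqr_ge0 (a 0 1 + b 0 1).
  by rewrite in_itv /= dotE => *; apply/andP; split; lra.
rewrite h -cos_2pi3 cosK// in_itv /=; apply/andP; split; lra.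
Qed.

(** The sum is a unit vector s; both a - b and c - d are orthogonal to s with squared length 3, so
    they agree up to sign, and the sign is the order of the pair. *)
Lemma unit_pair_sum_eq a b c d :
  enorm a = 1 -> enorm b = 1 -> enorm c = 1 -> enorm d = 1 ->
  dot a b = - 2^-1 -> a + b = c + d -> (a = c /\ b = d) \/ (a = d /\ b = c).
Proof.
move=> /enorm1P ha /enorm1P hb /enorm1P hc /enorm1P hd; rewrite dotE => hab.
move=> /rowP e; have := e 0; have := e 1; rewrite !mxE => {e}.
move: ha hb hc hd hab.
move: (@rV2P a c) (@rV2P b d) (@rV2P a d) (@rV2P b c).
move: (a 0 0) (a 0 1) (b 0 0) (b 0 1) (c 0 0) (c 0 1) (d 0 0) (d 0 1).
move=> a0 a1 b0 b1 c0 c1 d0 d1 Eac Ebd Ead Ebc ha hb hc hd hab e1 e0.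
pose s0 := a0 + b0; pose s1 := a1 + b1.
have s1E : s0 ^+ 2 + s1 ^+ 2 = 1 by rewrite /s0 /s1; lra.
have hcd : c0 * d0 + c1 * d1 = - 2^-1.
  have : (c0 + d0) ^+ 2 + (c1 + d1) ^+ 2 = 1 by rewrite -e0 -e1.
  by lra.
(* both differences are orthogonal to the common unit sum, hence multiples of its rotation *)
pose l := (a1 - b1) * s0 - (a0 - b0) * s1.
pose m := (c1 - d1) * s0 - (c0 - d0) * s1.
have key (x0 x1 y0 y1 : R) : x0 ^+ 2 + x1 ^+ 2 = 1 -> y0 ^+ 2 + y1 ^+ 2 = 1 ->
    x0 + y0 = s0 -> x1 + y1 = s1 ->
    let k := (x1 - y1) * s0 - (x0 - y0) * s1 in
    x0 - y0 = - (k * s1) /\ x1 - y1 = k * s0.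
  move=> hx hy h0 h1 k.
  have orth : (x0 - y0) * s0 + (x1 - y1) * s1 = 0 by rewrite -h0 -h1; nra.
  split.
    transitivity ((x0 - y0) * (s0 ^+ 2 + s1 ^+ 2)); first by rewrite s1E mulr1.
    have -> : (x0 - y0) * (s0 ^+ 2 + s1 ^+ 2) =
      - (k * s1) + s0 * ((x0 - y0) * s0 + (x1 - y1) * s1) by rewrite /k; ring.
    by rewrite orth mulr0 addr0.
  transitivity ((x1 - y1) * (s0 ^+ 2 + s1 ^+ 2)); first by rewrite s1E mulr1.
  have -> : (x1 - y1) * (s0 ^+ 2 + s1 ^+ 2) =
    (k * s0) + s1 * ((x0 - y0) * s0 + (x1 - y1) * s1) by rewrite /k; ring.
  by rewrite orth mulr0 addr0.
have [l0 l1] := key a0 a1 b0 b1 ha hb erefl erefl.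
have [m0 m1] := key c0 c1 d0 d1 hc hd (esym e0) (esym e1).
rewrite -/l in l0 l1; rewrite -/m in m0 m1.
have lm : (l - m) * (l + m) = 0.
  have h1 : l ^+ 2 = 3.
    transitivity ((l * s1) ^+ 2 + (l * s0) ^+ 2).
      by rewrite -[LHS]mulr1 -s1E; ring.
    by rewrite -l1 -[l * s1]opprK -l0 sqrrN; lra.
  have h2 : m ^+ 2 = 3.
    transitivity ((m * s1) ^+ 2 + (m * s0) ^+ 2).
      by rewrite -[LHS]mulr1 -s1E; ring.
    by rewrite -m1 -[m * s1]opprK -m0 sqrrN; lra.
  by rewrite -subr_sqr h1 h2 subrr.
move/eqP: lm; rewrite mulf_eq0 => /orP[/eqP h|/eqP h].
- left; have hl : l = m by lra.
  rewrite hl in l0 l1.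
  by split; [apply: Eac|apply: Ebd]; lra.
- right; have hl : l = - m by lra.
  rewrite hl in l0 l1.
  by split; [apply: Ead|apply: Ebc]; lra.
Qed.

(* [t *: (a + e)] and [t' *: (a' + e')] are the chords of two short curves
   with nearly constant tangents. *)
Lemma short_chords (t t' : R) (a a' e e' : 'rV[R]_2) :
  enorm a = 1 -> enorm a' = 1 -> dot a a' = - 2^-1 ->
  enorm e ^+ 2 <= 64^-1 -> enorm e' ^+ 2 <= 64^-1 -> 0 <= t -> 0 <= t' ->
  t *: (a + e) = t' *: (a' + e') -> t + t' = 0.
Proof.
move=> /enorm1P ha /enorm1P ha'; rewrite dotE !enorm_sqr => haa he he' t0 t0'.
move=> /rowP E; have := E 0; have := E 1; rewrite !mxE => {E}.
move: (a 0 0) (a 0 1) (a' 0 0) (a' 0 1) (e 0 0) (e 0 1) (e' 0 0) (e' 0 1)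
  ha ha' haa he he' => p q p' q' r s r' s' ha ha' haa he he' E1 E0.
(* The scalar product of the two directions. The bound 1/64 means |e|, |e'| <= 1/8, which keeps it
   negative. *)
pose X := (p + r) * (p' + r') + (q + s) * (q' + s').
have h1 : p * r' + q * s' <= 8^-1.
  by have := sqr_ge0 (p - 8 * r'); have := sqr_ge0 (q - 8 * s'); lra.
have h2 : r * p' + s * q' <= 8^-1.
  by have := sqr_ge0 (p' - 8 * r); have := sqr_ge0 (q' - 8 * s); lra.
have h3 : r * r' + s * s' <= 64^-1.
  by have := sqr_ge0 (r - r'); have := sqr_ge0 (s - s'); lra.
have X0 : X < 0 by rewrite /X; lra.
(* For equal chords this is the squared length of the common chord. *)
have : 0 <= t * t' * X.
  have -> : t * t' * X = (t * (p + r)) ^+ 2 + (t * (q + s)) ^+ 2.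
    by rewrite !expr2 {2}E0 {2}E1 /X; ring.
  by rewrite addr_ge0 ?sqr_ge0.
rewrite nmulr_lge0// => tt0.
have h4 : - 8^-1 <= p' * r' + q' * s'.
  by have := sqr_ge0 (p' + 8 * r'); have := sqr_ge0 (q' + 8 * s'); lra.
have h5 : - 8^-1 <= p * r + q * s.
  by have := sqr_ge0 (p + 8 * r); have := sqr_ge0 (q + 8 * s); lra.
have : t * t' = 0 by apply/eqP; rewrite eq_le tt0 mulr_ge0.
(* A direction a + e is nonzero since a . (a + e) >= 7/8; once one of the factors vanishes, so does
   the common chord and hence the other factor. *)
have nz (x u v y z : R) : u ^+ 2 + v ^+ 2 = 1 -> - 8^-1 <= u * y + v * z ->
    x * (u + y) = 0 -> x * (v + z) = 0 -> x = 0.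
  move=> huv hyz /eqP hx /eqP hx'; apply/eqP.
  move: hx hx'; rewrite !mulf_eq0 => /orP[//|/eqP hu] /orP[//|/eqP hv].
  have eu : y = - u by lra.
  have ev : z = - v by lra.
  by rewrite eu ev in hyz; lra.
move=> /eqP; rewrite mulf_eq0 => /orP[/eqP tz|/eqP tz].
- rewrite tz !mul0r in E0 E1.
  by rewrite tz (nz t' p' q' r' s')// add0r.
- rewrite tz !mul0r in E0 E1.
  by rewrite tz (nz t p q r s)// addr0.
Qed.

End plane_geometry.

(** * Networks *)

Lemma zero_in01 (R : realType) : 0 <= (0 : R) <= 1.
Proof. by rewrite lexx ler01. Qed.

Lemma one_in01 (R : realType) : 0 <= (1 : R) <= 1.
Proof. by rewrite lexx ler01. Qed.

Section networks.
Context {R : realType}.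
Local Notation mu := (@lebesgue_measure R).
Local Notation I01 := (`]0, 1[%classic : set R).
Local Notation E2 f := (\int[mu]_(x in I01) (f x ^+ 2)).
Implicit Types (g : R -> 'rV[R]_2) (G : 'I_3 -> R -> 'rV[R]_2)
  (T : 'I_3 -> 'rV[R]_2).

Lemma constant_speedE g x : constant_speed g -> 0 <= x <= 1 ->
  enorm (curve_x g x) = length g.
Proof. by move=> cs x01; apply: cs; rewrite in_itv. Qed.

Lemma length_ge0 g : 0 <= length g.
Proof. by apply: Rintegral_ge0 => x _; exact: enorm_ge0. Qed.

Lemma curve_energyE g :
  curve_energy g = (length g ^+ 3)^-1 * bending g + length g.
Proof. by []. Qed.

Lemma tangentE g (l : R) (a : 'rV[R]_2) x : enorm a = 1 -> 0 < l ->
  curve_x g x = l *: a -> tangent g x = a.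
Proof.
move=> ha l0 e; rewrite /tangent e enormZ ?(ltW l0)// ha mulr1 scalerA.
by rewrite mulVf ?scale1r// gt_eqF.
Qed.

Lemma tangent_unit g x : constant_speed g -> regular g -> 0 <= x <= 1 ->
  [/\ 0 < length g, enorm (tangent g x) = 1 &
      curve_x g x = length g *: tangent g x].
Proof.
move=> cs rg x01; have xI : x \in `[0, 1] by rewrite in_itv.
have := rg x xI; rewrite constant_speedE// => ln.
have lp : 0 < length g by rewrite lt_def ln length_ge0.
split => //; rewrite /tangent constant_speedE//.
  by rewrite enormZ ?invr_ge0 ?length_ge0// constant_speedE// mulVf.
by rewrite scalerA divff// scale1r.
Qed.

Local Opaque length bending enorm tangent curve_x.

Lemma curve_energy_ge0 g : 0 <= curve_energy g.
Proof.
by rewrite curve_energyE addr_ge0 ?length_ge0// mulr_ge0 ?bending_ge0//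
  invr_ge0 exprn_ge0// length_ge0.
Qed.

(* A curve of length 0 contributes nothing because [0^-1 = 0]. *)
Lemma curve_energy_length0 g : length g = 0 -> curve_energy g = 0.
Proof. by move=> l0; rewrite curve_energyE l0 expr0n invr0 mul0r addr0. Qed.

(** When the length is 0 the energy carries no information on the bending, because 0^-1 = 0; this
    fills the gap in [bending_le]. *)
Lemma bending_stationary g : class_H2 g ->
  (forall x, 0 <= x <= 1 -> curve_x g x = 0) -> bending g = 0.
Proof.
move=> Hg g0.
have p0 : primitive01 (fun=> 0 : R) (fun=> 0).
  by move=> x y x0 xy y1; rewrite subrr Rintegral_itv_cst// mul0r.
have c0 : {within `[(0:R), 1], continuous (fun=> 0 : R)}.
  by apply: continuous_subspaceT => x; exact: cvg_cst.
have e0 (j : 'I_2) : (fun _ : R => (0 : 'rV[R]_2) 0 j) = fun=> 0 :> R.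
  by apply/funext => x; rewrite mxE.
have [|||| _ _ ->] := @class_H2_intro _ g (fun=> 0) (fun=> 0).
- by move=> j; rewrite e0.
- move=> j; rewrite e0; have [_ pj _ _ _] := class_H2_C1 Hg j.
  by apply: primitive01_congr pj => // x /g0 ->; rewrite mxE.
- by move=> j; rewrite e0; exact: continuous01_sq.
- by move=> j; rewrite e0; exact: primitive01_weak01.
rewrite big1// => j _.
rewrite (@eq_Rintegral _ _ _ _ _ (fun=> 0)).
  by rewrite Rintegral_I01_cst.
by move=> x _; rewrite mxE expr0n.
Qed.

Lemma bending_le g (M : R) : class_H2 g -> constant_speed g ->
  curve_energy g <= M -> bending g <= M * length g ^+ 3.
Proof.
move=> Hg cs; rewrite curve_energyE => gM.
have l0 := length_ge0 g.
have [lz|ln] := eqVneq (length g) 0.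
  rewrite bending_stationary// ?lz ?expr0n ?mulr0// => x x01.
  by apply: enorm_sqr_le0; rewrite constant_speedE// lz expr0n.
have lp : 0 < length g ^+ 3 by rewrite exprn_gt0// lt_def ln.
by rewrite -ler_pdivrMr// mulrC (le_trans _ gM)// lerDl.
Qed.

Lemma length_le g (M : R) : curve_energy g <= M -> length g <= M.
Proof.
rewrite curve_energyE; apply: le_trans; rewrite lerDr mulr_ge0 ?bending_ge0//.
by rewrite invr_ge0 exprn_ge0// length_ge0.
Qed.

(** The quantity squared is the mean of F - F 0 over [0, 1], and |F - F 0| is at most the square
    root of [E2 f] there. *)
Lemma primitive01_chord (P F f : R -> R) : sq01 f -> primitive01 F f ->
  primitive01 P F -> (P 1 - P 0 - F 0) ^+ 2 <= E2 f.
Proof.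
move=> sf Ff PF.
have cF := primitive01_continuous (sq01_int sf) Ff.
have iF := Rintegrable_cc (continuous_Rintegrable cF).
have m1 : measurable (`[0, 1]%classic : set (measurableTypeR R)) by [].
have ic (c : R) : Rintegrable `[0, 1] (fun=> c).
  exact: Rintegrable_cc (Rintegrable_cst c).
pose r := Num.sqrt (E2 f).
have hr x : 0 <= x <= 1 -> `|F x - F 0| <= r.
  move=> /andP[x0 x1]; rewrite -sqrtr_sqr ler_wsqrtr//.
  apply: (le_trans (primitive01_CauchySchwarz sf Ff (lexx 0) x0 x1)).
  by rewrite subr0 ler_piMl// E2_ge0.
have : `|P 1 - P 0 - F 0| <= r.
  rewrite PF// -[X in _ - X]mulr1 -[X in _ - _ * X](subr0 1) -Rintegral_itv_cst//.
  rewrite -RintegralB//; last exact: ic.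
  apply: (le_trans (le_normr_Rintegral m1 (RintegrableB m1 iF (ic _)))).
  have -> : r = \int[mu]_(x in `[0, 1]) r by rewrite Rintegral_itv_cst// subr0 mulr1.
  apply: le_Rintegral => //.
  - by apply: Rintegrable_norm; apply: RintegrableB => //; exact: ic.
  - exact: ic.
move=> h; rewrite -(real_normK (num_real _)) -[leRHS](sqr_sqrtr (E2_ge0 f)).
by rewrite lerXn2r ?nnegrE// sqrtr_ge0.
Qed.

Lemma chord_estimate g : class_H2 g ->
  enorm (g 1 - g 0 - curve_x g 0) ^+ 2 <= bending g.
Proof.
move=> Hg; have C := class_H2_C1 Hg.
rewrite bendingE; last by move=> j; have [] := C j.
rewrite enorm_sqr !mxE sum_ord2.
have [_ q0 s0 p0 _] := C 0; have [_ q1 s1 p1 _] := C 1.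
have h0 := primitive01_chord s0 p0 q0.
have h1 := primitive01_chord s1 p1 q1.
exact: lerD.
Qed.

Lemma ord3_cases (i : 'I_3) : [\/ i = 0, i = 1 | i = 2%:R].
Proof.
by case: i => -[|[|[|//]]] p; [apply: Or31|apply: Or32|apply: Or33]; exact: val_inj.
Qed.

Lemma sum_ord3 (V : nmodType) (f : 'I_3 -> V) :
  \sum_(i < 3) f i = f 0 + f 1 + f 2%:R.
Proof.
rewrite !big_ord_recl big_ord0 addr0 addrA.
by congr (f _ + f _ + f _); exact: val_inj.
Qed.

(* Tangent directions at the two junctions, including a limit direction for a
   curve of length 0. *)
Definition junction_tangents G T0 T1 : Prop :=
  [/\ forall i, enorm (T0 i) = 1 /\ enorm (T1 i) = 1,
      \sum_(i < 3) T0 i = 0 /\ \sum_(i < 3) T1 i = 0,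
      forall i, curve_x (G i) 0 = length (G i) *: T0 i /\
                curve_x (G i) 1 = length (G i) *: T1 i,
      forall i, length (G i) = 0 -> T0 i = T1 i &
      forall i j, i != j -> 0 < length (G i) + length (G j)].

Lemma unit_sum0_dot T (i j : 'I_3) : (forall i, enorm (T i) = 1) ->
  \sum_(i < 3) T i = 0 -> i != j -> dot (T i) (T j) = - 2^-1.
Proof.
move=> uT; rewrite sum_ord3 => s0.
have dC (a b : 'rV[R]_2) : dot a b = dot b a by rewrite !dotE; ring.
have d01 : dot (T 0) (T 1) = - 2^-1 by apply: dot_unit_sum0 s0.
have d12 : dot (T 1) (T 2%:R) = - 2^-1.
  by apply: (@dot_unit_sum0 _ _ _ (T 0)) => //; rewrite -[RHS]s0 [LHS]addrC addrA.
have d02 : dot (T 0) (T 2%:R) = - 2^-1.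
  by apply: (@dot_unit_sum0 _ _ _ (T 1)) => //; rewrite -[RHS]s0 addrAC.
by case: (ord3_cases i) => ->; case: (ord3_cases j) => -> //= _; rewrite dC.
Qed.

Definition energy G : R := \sum_(i < 3) curve_energy (G i).

Lemma curve_energy_le G (i : 'I_3) : curve_energy (G i) <= energy G.
Proof.
rewrite /energy (bigD1 i)//= lerDl; apply: sumr_ge0 => j _.
exact: curve_energy_ge0.
Qed.

(** Division by L^2 of L^2 |T1 - T0|^2 <= bending <= M L^3. In the limit it forces the two
    directions of a collapsing curve to agree. *)
Lemma junction_tangents_close G T0 T1 (M : R) : network G ->
  junction_tangents G T0 T1 -> energy G <= M ->
  forall i, enorm (T1 i - T0 i) ^+ 2 <= M * length (G i).
Proof.
move=> [H2 cs _ _] [uT _ vT zT _] EM i.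
have [lz|ln] := eqVneq (length (G i)) 0.
  by rewrite zT// lz mulr0 subrr enorm_sqr !mxE expr0n addr0.
have lp : 0 < length (G i) by rewrite lt_def ln length_ge0.
have h := curve_x_holder (H2 i) (lexx 0) ler01 (lexx 1).
have [v0 v1] := vT i.
rewrite v0 v1 -scalerBr enormZ ?length_ge0// exprMn subr0 mul1r in h.
have h' := bending_le (H2 i) (cs i) (le_trans (curve_energy_le G i) EM).
have l2 : 0 < length (G i) ^+ 2 by rewrite exprn_gt0.
rewrite -(ler_pM2l l2); apply: (le_trans h); apply: (le_trans h').
by rewrite exprSr mulrCA.
Qed.

(** If the bound failed, both chords would satisfy [short_chords] and both lengths would vanish,
    against the last clause of [junction_tangents]. *)
Lemma junction_lengths G T0 T1 (M : R) : network G ->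
  junction_tangents G T0 T1 -> energy G <= M ->
  forall i j, i != j -> 64^-1 <= M * (length (G i) + length (G j)).
Proof.
move=> nG [uT [sT _] vT zT pL] EM i j ij.
have [H2 cs e0 e1] := nG.
have M0 : 0 <= M.
  by apply: le_trans EM; apply: sumr_ge0 => k _; exact: curve_energy_ge0.
rewrite leNgt; apply/negP => small.
have chord k : M * length (G k) <= 64^-1 -> exists e : 'rV[R]_2,
    enorm e ^+ 2 <= 64^-1 /\ G k 1 - G k 0 = length (G k) *: (T0 k + e).
  move=> sk; have h := chord_estimate (H2 k).
  have h' := bending_le (H2 k) (cs k) (le_trans (curve_energy_le G k) EM).
  have {h h'}h := le_trans h h'; have [v0 _] := vT k.
  have [lz|ln] := eqVneq (length (G k)) 0.
    exists 0; split; first by rewrite enorm_sqr !mxE expr0n addr0 invr_ge0.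
    rewrite v0 lz scale0r subr0 expr0n mulr0 in h.
    by rewrite lz scale0r; exact: enorm_sqr_le0.
  have lp : 0 < length (G k) by rewrite lt_def ln length_ge0.
  exists ((length (G k))^-1 *: (G k 1 - G k 0 - curve_x (G k) 0)); split.
    rewrite enormZ ?invr_ge0 ?length_ge0// exprMn.
    apply: le_trans sk; rewrite exprVn mulrC ler_pdivrMr ?exprn_gt0//.
    by rewrite -mulrA -exprS.
  by rewrite scalerDr scalerA divff// scale1r v0 [RHS]addrC subrK.
have li := length_ge0 (G i); have lj := length_ge0 (G j).
have si : M * length (G i) <= 64^-1.
  by apply: (le_trans _ (ltW small)); apply: ler_wpM2l; [exact: M0|rewrite lerDl; exact: lj].
have sj : M * length (G j) <= 64^-1.
  by apply: (le_trans _ (ltW small)); apply: ler_wpM2l; [exact: M0|rewrite lerDr; exact: li].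
have [ei [hei Ei]] := chord i si.
have [ej [hej Ej]] := chord j sj.
have Eij : length (G i) *: (T0 i + ei) = length (G j) *: (T0 j + ej).
  apply: (etrans (esym Ei)); apply: etrans Ej.
  by congr (_ - _); [exact: e1|exact: e0].
have dij : dot (T0 i) (T0 j) = - 2^-1.
  by apply: unit_sum0_dot => // k; have [] := uT k.
have [ui _] := uT i; have [uj _] := uT j.
have := pL i j ij.
by rewrite (short_chords ui uj dij hei hej li lj Eij) ltxx.
Qed.

Lemma theta_junction_tangents G : theta_network G ->
  exists T0 T1, junction_tangents G T0 T1.
Proof.
move=> [[H2 cs _ _] rG s0 s1].
exists (fun i => tangent (G i) 0), (fun i => tangent (G i) 1).
have t0 i := tangent_unit (cs i) (rG i) (zero_in01 R).
have t1 i := tangent_unit (cs i) (rG i) (one_in01 R).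
split => //.
- by move=> i; have [_ ? _] := t0 i; have [_ ? _] := t1 i.
- by move=> i; have [_ _ ?] := t0 i; have [_ _ ?] := t1 i.
- by move=> i l0; have [] := t0 i; rewrite l0 ltxx.
- by move=> i j _; have [hi _ _] := t0 i; have [hj _ _] := t0 j; exact: (addr_gt0 hi hj).
Qed.

End networks.

(** * Theta-networks and degenerate ones in terms of junction tangents *)

Section network_characterization.
Context {R : realType}.
Local Notation mu := (@lebesgue_measure R).
Implicit Types (g : R -> 'rV[R]_2) (G : 'I_3 -> R -> 'rV[R]_2)
  (T : 'I_3 -> 'rV[R]_2).

Lemma curve_x_constant g (P : 'rV[R]_2) (x : R) :
  (forall y : R, 0 <= y <= 1 -> g y = P) -> 0 <= x <= 1 -> curve_x g x = 0.
Proof.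
move=> gP x01; apply: curve_x_lim => // j; rewrite mxE.
apply: cvg_near_cst; rewrite near_withinE; apply: nearW => y.
by rewrite /= in_itv /= => y01; rewrite !gP// subrr mulr0.
Qed.

Local Opaque length bending enorm tangent curve_x.

Lemma curve_x_length0 g (x : R) : constant_speed g -> length g = 0 ->
  0 <= x <= 1 -> curve_x g x = 0.
Proof.
by move=> cs l0 x01; apply: enorm_sqr_le0; rewrite constant_speedE// l0 expr0n.
Qed.

Lemma length0_constant g (x : R) : class_H2 g -> constant_speed g ->
  length g = 0 -> 0 <= x <= 1 -> g x = g 0.
Proof.
move=> Hg cs l0 /andP[x0 x1].
have p j : g x 0 j - g 0 0 j = 0.
  have [_ pj _ _ _] := class_H2_C1 Hg j.
  rewrite (pj 0 x)// (@eq_Rintegral _ _ _ _ _ (fun=> 0)).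
    by rewrite Rintegral_itv_cst// mul0r.
  move=> t; rewrite inE /= in_itv /= => /andP[t0 tx].
  by rewrite curve_x_length0 ?mxE// t0 (le_trans tx).
by apply/rowP => j; apply/eqP; rewrite -subr_eq0; apply/eqP; exact: p.
Qed.

Lemma junction_tangents_perm G T0 T1 (s : 'S_3) :
  junction_tangents (fun k => G (s k)) T0 T1 ->
  junction_tangents G (fun i => T0 ((s^-1)%g i)) (fun i => T1 ((s^-1)%g i)).
Proof.
move=> [uT [s0 s1] vT zT pL]; split.
- by move=> i; exact: uT.
- split.
    by rewrite -[RHS]s0 [RHS](reindex_inj (@perm_inj _ (s^-1)%g)).
  by rewrite -[RHS]s1 [RHS](reindex_inj (@perm_inj _ (s^-1)%g)).
- by move=> i; have := vT ((s^-1)%g i); rewrite permKV.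
- by move=> i; have := zT ((s^-1)%g i); rewrite permKV.
- move=> i j ij; have := pL ((s^-1)%g i) ((s^-1)%g j).
  by rewrite !permKV; apply; rewrite (inj_eq perm_inj).
Qed.

(** The collapsed curve receives the direction that closes the sum, minus the sum of the other two
    tangents; it is the same at both junctions because the two pairs of tangents form the same
    set. *)
Lemma degenerate_junction_tangents G : degenerate_theta_network G ->
  exists T0 T1, junction_tangents G T0 T1.
Proof.
move=> [[H2 cs e0 e1] [s [P [[r0 r1] gP [P00 P01 P10 P11] ang st]]]].
have [l0 ua va] := tangent_unit (cs (s 0)) r0 (zero_in01 R).
have [_ uc vc] := tangent_unit (cs (s 0)) r0 (one_in01 R).
have [l1 ub vb] := tangent_unit (cs (s 1)) r1 (zero_in01 R).
have [_ ud vd] := tangent_unit (cs (s 1)) r1 (one_in01 R).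
move: (tangent (G (s 0)) 0) (tangent (G (s 0)) 1) (tangent (G (s 1)) 0)
  (tangent (G (s 1)) 1) ua va uc vc ub vb ud vd ang st
  => a c b d ua va uc vc ub vb ud vd ang st.
have dab := (angle_unit ua ub).1 ang.
have gP' (y : R) : 0 <= y <= 1 -> G (s 2%:R) y = P.
  by move=> y01; apply: gP; rewrite in_itv.
have v2 x : 0 <= x <= 1 -> curve_x (G (s 2%:R)) x = 0.
  exact: curve_x_constant gP'.
have l2 : length (G (s 2%:R)) = 0.
  rewrite -(constant_speedE (cs _) (zero_in01 R)) v2; last exact: zero_in01.
  by have := enormZ (0 : 'rV[R]_2) (lexx (0 : R)); rewrite scale0r mul0r.
(* Distinctness turns the equality of sets into an equality of sums. *)
have nab : a <> b.
  move=> ab; move: dab ua; rewrite ab dotE => h /enorm1P h'.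
  have : (0 : R) < - 2^-1 by rewrite -h -!expr2 h'.
  by rewrite oppr_gt0 ltNge invr_ge0 ler0n.
have ab_cd : a + b = c + d.
  have : [set c; d] a by rewrite -st; left.
  have : [set c; d] b by rewrite -st; right.
  move=> [bc|bd] [ac|ad].
  - by case: nab; rewrite ac bc.
  - by rewrite ad bc addrC.
  - by rewrite ac bd.
  - by case: nab; rewrite ad bd.
pose third (x y z : 'rV[R]_2) (k : 'I_3) := if k == 0 then x else if k == 1 then y else z.
have third_sum x y : \sum_(k < 3) third x y (- (x + y)) k = 0.
  by rewrite sum_ord3 /third /= subrr.
have uab : enorm (- (a + b)) = 1.
  apply/enorm1P; rewrite !mxE !sqrrN.
  by have /enorm1P := enorm_unitD ua ub dab; rewrite !mxE.
exists (fun i => third a b (- (a + b)) ((s^-1)%g i)),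
  (fun i => third c d (- (c + d)) ((s^-1)%g i)).
apply: junction_tangents_perm; split.
- by move=> k; case: (ord3_cases k) => ->; rewrite /third /= -?ab_cd.
- by split; exact: third_sum.
- move=> k; case: (ord3_cases k) => ->; rewrite /third /=.
  + by [].
  + by [].
  + by rewrite l2 !scale0r !v2 ?zero_in01 ?one_in01.
- move=> k; case: (ord3_cases k) => ->; rewrite /third /=.
  + by move=> h; move: l0; rewrite h ltxx.
  + by move=> h; move: l1; rewrite h ltxx.
  + by rewrite ab_cd.
- move=> i j; case: (ord3_cases i) => ->; case: (ord3_cases j) => -> //= _.
  + exact: addr_gt0 l0 l1.
  + rewrite l2 addr0; exact: l0.
  + exact: addr_gt0 l1 l0.
  + rewrite l2 addr0; exact: l1.
  + rewrite l2 add0r; exact: l0.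
  + rewrite l2 add0r; exact: l1.
Qed.

Lemma junction_tangents_characterization G T0 T1 : network G ->
  junction_tangents G T0 T1 -> theta_network G \/ degenerate_theta_network G.
Proof.
move=> nG [uT [s0 s1] vT zT pL]; have [H2 cs e0 e1] := nG.
have tE i : length (G i) != 0 -> [/\ regular (G i),
    tangent (G i) 0 = T0 i & tangent (G i) 1 = T1 i].
  move=> ln; have lp : 0 < length (G i) by rewrite lt_def ln length_ge0.
  have [u0 u1] := uT i; have [v0 v1] := vT i.
  split; [|exact: tangentE v0|exact: tangentE v1].
  by move=> x; rewrite in_itv /= => x01; rewrite constant_speedE.
have [[k lk]|nz] := pselect (exists k, length (G k) = 0); last first.
  have ln i : length (G i) != 0 by apply/eqP => h; apply: nz; exists i.
  left; split => //.
  - by move=> i; have [] := tE i (ln i).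
  - by rewrite -[RHS]s0; apply: eq_bigr => i _; have [] := tE i (ln i).
  - by rewrite -[RHS]s1; apply: eq_bigr => i _; have [] := tE i (ln i).
right; split => //.
have [s sk] : exists s : 'S_3, s 2%:R = k.
  by exists (tperm 2%:R k); rewrite tpermL.
exists s, (G k 0).
have ne (i : 'I_3) : i != 2%:R -> s i != k.
  by move=> i2; rewrite -sk (inj_eq perm_inj).
have ln i : s i != k -> length (G (s i)) != 0.
  by move=> ik; have := pL (s i) k ik; rewrite lk addr0 => /gt_eqF ->.
have [r0 t00 t01] := tE _ (ln _ (ne 0 isT)).
have [r1 t10 t11] := tE _ (ln _ (ne 1 isT)).
have [u00 u01] := uT (s 0); have [u10 u11] := uT (s 1).
have kc := length0_constant (H2 k) (cs k) lk.
have d01 : dot (T0 (s 0)) (T0 (s 1)) = - 2^-1.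
  apply: unit_sum0_dot => //; last by rewrite (inj_eq perm_inj).
  by move=> i; have [] := uT i.
rewrite sk; split.
- by split; [exact: r0|exact: r1].
- by move=> x; rewrite in_itv /= => /kc.
- split; [exact: e0|by rewrite (e1 _ k) kc ?one_in01|exact: e0|by rewrite (e1 _ k) kc ?one_in01].
- by rewrite t00 t10; apply/angle_unit.
- rewrite t00 t01 t10 t11.
  (* The direction of the collapsed curve is common to both junctions, so the other two have the
     same sum at both, and their pair is determined. *)
  have sumE T : \sum_(i < 3) T i = 0 -> T (s 0) + T (s 1) = - T k.
    rewrite (reindex_inj (@perm_inj _ s)) /= sum_ord3 sk => /eqP.
    by rewrite addr_eq0 => /eqP.
  have e : T0 (s 0) + T0 (s 1) = T1 (s 0) + T1 (s 1).
    by rewrite (sumE T0)// (sumE T1)// zT.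
  have [[-> ->]//|[-> ->]] := unit_pair_sum_eq u00 u10 u01 u11 d01 e.
  by rewrite setUC.
Qed.

(** Curves of length 0 may be put back into the sum, so one formula serves both kinds of network. *)
Lemma Fbar_energy G : theta_network G \/ degenerate_theta_network G ->
  Fbar G = (energy G)%:E.
Proof.
rewrite /Fbar; case: asboolP => [//|nt [//|dG]].
rewrite asboolT// /energy; congr EFin; rewrite big_mkcond /=.
apply: eq_bigr => i _; case: ltP => // l0; rewrite curve_energy_length0//.
by apply/eqP; rewrite eq_le l0 length_ge0.
Qed.

End network_characterization.

(** * A competitor and the limit of a minimising sequence *)

Section existence.
Context {R : realType}.
Local Notation mu := (@lebesgue_measure R).
Implicit Types (G : 'I_3 -> R -> 'rV[R]_2).

Lemma is_derive_primitive01 (F f : R -> R) :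
  (forall x : R, is_derive x (1 : R) F (f x)) -> continuous f -> primitive01 F f.
Proof.
move=> dF cf x y x0; rewrite le_eqVlt => /predU1P[->|xy] y1.
  by rewrite subrr set_itv1 Rintegral_set1.
have cF : continuous F.
  move=> z; apply: differentiable_continuous; apply/derivable1_diffP.
  by have [] := dF z.
rewrite /Rintegral (@continuous_FTC2 _ f F)//.
- exact: continuous_subspaceT.
- split.
  + by move=> z _; have [] := dF z.
  + exact/cvg_at_right_filter/cF.
  + exact/cvg_at_left_filter/cF.
- by move=> z _; rewrite derive1E; have [_ ->] := dF z.
Qed.

Let w : R := pi *+ 2.
(** Trigonometric polynomials of period 1 and degree one, a family closed under differentiation. *)
Let trig (c d e x : R) := c * sin (w * x) + d * cos (w * x) + e.

Let is_derive_trig c d e (x : R) :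
  is_derive x (1 : R) (trig c d e) (trig (- (w * d)) (w * c) 0 x).
Proof.
have h0 : is_derive x (1 : R) (fun x => w * x) w.
  have := is_deriveZ w (is_derive_id x (1 : R)).
  by rewrite [w *: 1]mulr1.
have hs : is_derive x (1 : R) (fun x => sin (w * x)) (w * cos (w * x)).
  by rewrite [w * _]mulrC; exact: is_derive1_comp (is_derive_sin (w * x)) h0.
have hc : is_derive x (1 : R) (fun x => cos (w * x)) (- sin (w * x) * w).
  exact: is_derive1_comp (is_derive_cos (w * x)) h0.
have h := is_deriveD (is_deriveD (is_deriveZ c hs) (is_deriveZ d hc))
  (is_derive_cst e x (1 : R)).
apply: is_derive_eq h _.
rewrite /trig [c *: _]/GRing.scale [d *: _]/GRing.scale /=; ring.
Qed.

Let trig_continuous c d e : continuous (trig c d e).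
Proof.
move=> x; apply: differentiable_continuous; apply/derivable1_diffP.
by have [] := is_derive_trig c d e x.
Qed.

Let trig_primitive c d e c' d' : c' = - (w * d) -> d' = w * c ->
  primitive01 (trig c d e) (trig c' d' 0).
Proof.
move=> -> ->; apply: is_derive_primitive01; last exact: trig_continuous.
exact: is_derive_trig.
Qed.

Let w0 : w != 0.
Proof. by rewrite mulrn_eq0 /= gt_eqF ?pi_gt0. Qed.

Let trig0 c d e : trig c d e 0 = d + e.
Proof. by rewrite /trig mulr0 sin0 cos0 mulr0 add0r mulr1. Qed.

Let trig1 c d e : trig c d e 1 = d + e.
Proof. by rewrite /trig mulr1 sin2pi cos2pi mulr0 add0r mulr1. Qed.

Let pair_fun (f g : R -> R) (x : R) : 'rV[R]_2 := \row_j (if j == 0 then f x else g x).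

Let pair_funP (P : (R -> R) -> Prop) f g : P f -> P g ->
  forall j, P (fun x => pair_fun f g x 0 j).
Proof.
move=> Pf Pg j.
have [->|->] := ord2_cases j.
- by rewrite (_ : (fun x => _) = f)//; apply/funext => x; rewrite mxE.
- by rewrite (_ : (fun x => _) = g)//; apply/funext => x; rewrite mxE.
Qed.

(** The circle of length 1 through the origin with tangent [a] there: its velocity is [a] rotated by
    the angle w x. *)
Lemma circle_exists (a : 'rV[R]_2) : enorm a = 1 -> exists g,
  [/\ class_H2 g, constant_speed g /\ length g = 1, g 0 = 0 /\ g 1 = 0 &
      curve_x g 0 = a /\ curve_x g 1 = a].
Proof.
move=> /enorm1P ha.
pose p : R := a 0 0; pose q : R := a 0 1.
pose g := pair_fun (trig (p / w) (q / w) (- (q / w)))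
  (trig (q / w) (- (p / w)) (p / w)).
pose v := pair_fun (trig (- q) p 0) (trig p q 0).
pose u := pair_fun (trig (- (w * p)) (w * - q) 0) (trig (- (w * q)) (w * p) 0).
have c01 c d e : {within `[(0:R), 1], continuous (trig c d e)}.
  by apply: continuous_subspaceT; exact: trig_continuous.
have vc (j : 'I_2) : {within `[(0:R), 1], continuous (fun x => v x 0 j)}.
  by apply: (@pair_funP (fun f => {within `[(0:R), 1], continuous f})); exact: c01.
have [] := @class_H2_intro R g v u vc.
- move=> j; have [->|->] := ord2_cases j.
  + apply: (@primitive01_congr R (trig (p / w) (q / w) (- (q / w))) _ (trig (- q) p 0)).
    * by move=> x _; rewrite mxE.
    * by move=> x _; rewrite mxE.
    * by apply: trig_primitive; rewrite ?mulrN ?opprK mulrC divfK.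
  + apply: (@primitive01_congr R (trig (q / w) (- (p / w)) (p / w)) _ (trig p q 0)).
    * by move=> x _; rewrite mxE.
    * by move=> x _; rewrite mxE.
    * by apply: trig_primitive; rewrite ?mulrN ?opprK mulrC divfK.
- move=> j; apply: (@pair_funP (fun f => sq01 f)).
    exact: continuous01_sq.
  exact: continuous01_sq.
- move=> j; have [->|->] := ord2_cases j.
  + rewrite (_ : (fun x => v x 0 0) = trig (- q) p 0); last by apply/funext => x; rewrite mxE.
    rewrite (_ : (fun x => u x 0 0) = trig (- (w * p)) (w * - q) 0).
      by apply: primitive01_weak01 => //; exact: trig_primitive.
    by apply/funext => x; rewrite mxE.
  + rewrite (_ : (fun x => v x 0 1) = trig p q 0); last by apply/funext => x; rewrite mxE.
    rewrite (_ : (fun x => u x 0 1) = trig (- (w * q)) (w * p) 0).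
      by apply: primitive01_weak01 => //; exact: trig_primitive.
    by apply/funext => x; rewrite mxE.
move=> Hg gv _.
have [l1 cs] : length g = 1 /\ constant_speed g.
  apply: length_cst => x x01; rewrite gv//; apply/enorm1P; rewrite !mxE /=.
  transitivity ((p ^+ 2 + q ^+ 2) * (cos (w * x) ^+ 2 + sin (w * x) ^+ 2)).
    by rewrite /trig; ring.
  by rewrite cos2Dsin2 mulr1.
exists g; split => //.
- by split; apply: rV2P; rewrite !mxE /= ?trig0 ?trig1; ring.
- split; rewrite gv ?lexx ?ler01//; apply: rV2P; rewrite !mxE /= ?trig0 ?trig1 addr0//.
Qed.

Let s3 : R := Num.sqrt 3 / 2.

(** The cube roots of unity. *)
Let tripod (i : 'I_3) : 'rV[R]_2 :=
  \row_j (if j == 0 then if i == 0 then 1 else - 2^-1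
          else if i == 0 then 0 else if i == 1 then s3 else - s3).

Let s3_sqr : s3 ^+ 2 = 3 / 4.
Proof. by rewrite /s3 expr_div_n sqr_sqrtr//; field. Qed.

Let tripod_unit i : enorm (tripod i) = 1.
Proof.
apply/enorm1P; case: (ord3_cases i) => ->; rewrite !mxE /= ?sqrrN ?s3_sqr.
- by rewrite expr1n expr0n addr0.
- by field.
- by field.
Qed.

(** Both junctions sit at the origin, and each curve is a full circle leaving and returning in the
    same direction. *)
Lemma junction_tangents_exist : exists G T0 T1,
  network G /\ junction_tangents (R := R) G T0 T1.
Proof.
have [G hG] := choice (fun i => circle_exists (tripod_unit i)).
have l1 i : length (G i) = 1 by have [_ []] := hG i.
exists G, tripod, tripod; split.
  split.
  - by move=> i; have [] := hG i.
  - by move=> i; have [_ []] := hG i.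
  - by move=> i j; have [_ _ [-> _] _] := hG i; have [_ _ [-> _] _] := hG j.
  - by move=> i j; have [_ _ [_ ->] _] := hG i; have [_ _ [_ ->] _] := hG j.
split.
- by move=> i; split; exact: tripod_unit.
- have sT : \sum_(i < 3) tripod i = 0.
    by rewrite sum_ord3; apply: rV2P; rewrite !mxE /=; [field|ring].
  by split.
- by move=> i; rewrite l1 !scale1r; have [_ _ _] := hG i.
- by [].
- by move=> i j _; rewrite !l1.
Qed.

Local Opaque length bending enorm tangent curve_x curve_energy.

Lemma minimizing_limit (G_ : nat -> 'I_3 -> R -> 'rV[R]_2)
    (T0_ T1_ : nat -> 'I_3 -> 'rV[R]_2) (m : R) :
  (forall n, network (G_ n)) ->
  (forall n, junction_tangents (G_ n) (T0_ n) (T1_ n)) ->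
  (forall n, energy (G_ n) <= m + n.+1%:R^-1) ->
  exists G T0 T1, [/\ network G, junction_tangents G T0 T1 & energy G <= m].
Proof.
move=> nG jT Em.
have [U [UU oU]] := ultraFilterLemma (_ : ProperFilter \oo).
have PU := @ultra_proper _ _ UU.
have UE (P : nat -> Prop) : (\forall n \near \oo, P n) -> \forall n \near U, P n by exact: oU.
pose M := m + 1.
have EM n : energy (G_ n) <= M.
  by apply: (le_trans (Em n)); rewrite lerD2l invf_le1// ler1n.
have cEM n i : curve_energy (G_ n i) <= M by exact: le_trans (curve_energy_le _ i) (EM n).
have lM n i : length (G_ n i) <= M by exact: length_le (cEM n i).
have M0 : 0 <= M by exact: le_trans (length_ge0 _) (lM 0%N 0).
have H2 n i : class_H2 (G_ n i) by have [] := nG n.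
have cs n i : constant_speed (G_ n i) by have [] := nG n.
(* A common bound for the lengths, at most M, and the bendings, at most M L^3. *)
pose B := Num.max M (M * M ^+ 3).
have bB n i : bending (G_ n i) <= B.
  apply: (le_trans (bending_le (H2 n i) (cs n i) (cEM n i))).
  rewrite le_max; apply/orP; right; apply: ler_wpM2l => //.
  by apply: lerXn2r; rewrite ?nnegrE ?length_ge0// lM.
have lB n i : length (G_ n i) <= B by rewrite le_max lM.
have [G hG] := choice (fun i => curve_limit UU (H2 ^~ i) (cs ^~ i) (lB ^~ i) (bB ^~ i)).
have unit_bound (a : 'rV[R]_2) k : enorm a = 1 -> `|a 0 k| <= 1.
  move=> /enorm1P ha; rewrite -(ler_pXn2r (ltn0Sn 1)) ?nnegrE// real_normK ?num_real//.
  rewrite expr1n -ha.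
  have [->|->] := ord2_cases k.
  - by rewrite lerDl sqr_ge0.
  - by rewrite lerDr sqr_ge0.
have T0ex (q : 'I_3 * 'I_2) : exists t : R, (fun n => T0_ n q.1 0 q.2) @ U --> t.
  apply: (@ultra_cvg R _ _ _ 1) => // n; apply: unit_bound.
  by have [uT _ _ _ _] := jT n; have [] := uT q.1.
have T1ex (q : 'I_3 * 'I_2) : exists t : R, (fun n => T1_ n q.1 0 q.2) @ U --> t.
  apply: (@ultra_cvg R _ _ _ 1) => // n; apply: unit_bound.
  by have [uT _ _ _ _] := jT n; have [] := uT q.1.
have [t0 ht0] := choice T0ex; have [t1 ht1] := choice T1ex.
pose T0 i := \row_k t0 (i, k) : 'rV[R]_2.
pose T1 i := \row_k t1 (i, k) : 'rV[R]_2.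
have cT0 i k : (fun n => T0_ n i 0 k) @ U --> T0 i 0 k by rewrite mxE; exact: (ht0 (i, k)).
have cT1 i k : (fun n => T1_ n i 0 k) @ U --> T1 i 0 k by rewrite mxE; exact: (ht1 (i, k)).
have cl i : (fun n => length (G_ n i)) @ U --> length (G i) by have [_ ? _ _ _] := hG i.
have unit_limit (a_ : nat -> 'rV[R]_2) (a : 'rV[R]_2) :
    (forall k, (fun n => a_ n 0 k) @ U --> a 0 k) ->
    (forall n, enorm (a_ n) = 1) -> enorm a = 1.
  move=> ca ua; apply/enorm1P.
  have c1 : (fun n => a_ n 0 0 ^+ 2 + a_ n 0 1 ^+ 2) @ U --> a 0 0 ^+ 2 + a 0 1 ^+ 2.
    rewrite !expr2; under eq_fun do rewrite !expr2.
    by apply: cvgD; apply: cvgM; exact: ca.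
  have c2 : (fun n => a_ n 0 0 ^+ 2 + a_ n 0 1 ^+ 2) @ U --> (1 : R).
    by apply: cvg_near_cst; apply: nearW => n; have /enorm1P := ua n.
  exact: (cvg_unique _ c1 c2).
have sum_limit (a_ : nat -> 'I_3 -> 'rV[R]_2) (a : 'I_3 -> 'rV[R]_2) :
    (forall i k, (fun n => a_ n i 0 k) @ U --> a i 0 k) ->
    (forall n, \sum_(i < 3) a_ n i = 0) -> \sum_(i < 3) a i = 0.
  move=> ca sa; apply/rowP => k; rewrite sum_ord3 !mxE.
  have c1 : (fun n => a_ n 0 0 k + a_ n 1 0 k + a_ n 2%:R 0 k) @ U -->
      a 0 0 k + a 1 0 k + a 2%:R 0 k.
    by apply: cvgD; [apply: cvgD|]; exact: ca.
  have c2 : (fun n => a_ n 0 0 k + a_ n 1 0 k + a_ n 2%:R 0 k) @ U --> (0 : R).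
    apply: cvg_near_cst; apply: nearW => n.
    by have /rowP/(_ k) := sa n; rewrite sum_ord3 !mxE.
  exact: (cvg_unique _ c1 c2).
have speed_limit i x (a_ : nat -> 'rV[R]_2) (a : 'rV[R]_2) : 0 <= x <= 1 ->
    (forall k, (fun n => a_ n 0 k) @ U --> a 0 k) ->
    (forall n, curve_x (G_ n i) x = length (G_ n i) *: a_ n) ->
    curve_x (G i) x = length (G i) *: a.
  move=> x01 ca va; apply/rowP => k; rewrite mxE.
  have [_ _ _ cv _] := hG i; have {}cv := cv x x01 k.
  have c2 : (fun n => curve_x (G_ n i) x 0 k) @ U --> length (G i) * a 0 k.
    under eq_fun do rewrite va mxE.
    by apply: cvgM; [exact: cl|exact: ca].
  exact: (cvg_unique _ cv c2).
exists G, T0, T1; split.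
- split.
  + by move=> i; have [[]] := hG i.
  + by move=> i; have [[]] := hG i.
  + by move=> i j; have [[_ _ ->]] := hG i; have [[_ _ ->]] := hG j.
  (* The limit curves start at 0, so their endpoints are limits of chords, and the chords of each
     [G_ n] coincide. *)
  + move=> i j; apply/rowP => k.
    have [_ _ ci _ _] := hG i; have [_ _ cj _ _] := hG j.
    have cij : (fun n => G_ n i 1 0 k - G_ n i 0 0 k) @ U --> G j 1 0 k.
      apply: cvg_trans (cj k); apply: near_eq_cvg.
      apply: nearW => n; have [_ _ e0 e1] := nG n.
      by rewrite (e0 j i) (e1 j i).
    exact: (cvg_unique _ (ci k) cij).
- split.
  + move=> i; split.
    * by apply: (unit_limit (T0_ ^~ i)) => // n; have [uT _ _ _ _] := jT n; have [] := uT i.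
    * by apply: (unit_limit (T1_ ^~ i)) => // n; have [uT _ _ _ _] := jT n; have [] := uT i.
  + split.
    * by apply: (sum_limit T0_) => // n; have [_ [? ?] _ _ _] := jT n.
    * by apply: (sum_limit T1_) => // n; have [_ [? ?] _ _ _] := jT n.
  + move=> i; split.
    * apply: (speed_limit i 0 (T0_ ^~ i)) => [|//|n]; first exact: zero_in01.
      by have [_ _ vT _ _] := jT n; have [] := vT i.
    * apply: (speed_limit i 1 (T1_ ^~ i)) => [|//|n]; first exact: one_in01.
      by have [_ _ vT _ _] := jT n; have [] := vT i.
  + move=> i l0; apply/esym/eqP; rewrite -subr_eq0; apply/eqP; apply: enorm_sqr_le0.
    have c1 : (fun n => enorm (T1_ n i - T0_ n i) ^+ 2) @ U --> enorm (T1 i - T0 i) ^+ 2.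
      rewrite enorm_sqrB !expr2; under eq_fun do rewrite enorm_sqrB !expr2.
      by apply: cvgD; apply: cvgM; apply: cvgB; (exact: cT0 || exact: cT1).
    have c2 : (fun n => M * length (G_ n i)) @ U --> (0 : R).
      rewrite -(mulr0 M) -l0; apply: cvgM; [exact: cvg_cst|exact: cl].
    apply: (ler_cvg_to c1 c2); apply: nearW => n.
    exact: junction_tangents_close (nG n) (jT n) (EM n) i.
  (* Positivity survives because the lower bound 1/64 does not depend on [n]. *)
  + move=> i j ij.
    have c1 : (fun n => M * (length (G_ n i) + length (G_ n j))) @ U -->
        M * (length (G i) + length (G j)).
      by apply: cvgM; [exact: cvg_cst|apply: cvgD; exact: cl].
    have h : 64^-1 <= M * (length (G i) + length (G j)).
      apply: (cvgr_to_ge c1); apply: nearW => n.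
      exact: (junction_lengths (nG n) (jT n) (EM n) ij).
    have h0 : 0 <= length (G i) + length (G j) by rewrite addr_ge0 ?length_ge0.
    rewrite lt_def h0 andbT; apply/eqP => z; move: h.
    by rewrite z mulr0 leNgt invr_gt0 ltr0n.
(* Each of the three energies converges along the ultrafilter, so the curves can be treated one by
   one and the limits added. *)
- have cex (i : 'I_3) : exists c : R, (fun n => curve_energy (G_ n i)) @ U --> c.
    apply: (@ultra_cvg R _ _ _ M) => // n.
    by rewrite ger0_norm ?curve_energy_ge0.
  have [c hc] := choice cex.
  have bex (i : 'I_3) : exists b : R, (fun n => bending (G_ n i)) @ U --> b.
    apply: (@ultra_cvg R _ _ _ B) => // n.
    by rewrite ger0_norm ?bending_ge0.
  have [b hb] := choice bex.
  have Gc i : curve_energy (G i) <= c i.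
    (* A curve that collapses has energy 0 in the limit by convention, while energies are
       nonnegative; otherwise the factor L^-3 is continuous. *)
    have [lz|ln] := eqVneq (length (G i)) 0.
      rewrite curve_energy_length0//; apply: (cvgr_to_ge (hc i)).
      by apply: nearW => n; exact: curve_energy_ge0.
    have [_ _ _ _ /(_ _ (hb i)) bb] := hG i.
    have c1 : (fun n => curve_energy (G_ n i)) @ U -->
        (length (G i) ^+ 3)^-1 * b i + length (G i).
      under eq_fun do rewrite curve_energyE.
      apply: cvgD; last exact: cl.
      apply: cvgM; last exact: hb.
      apply: cvgV; first by rewrite expf_neq0.
      exact: (cvgM (cl i) (cvgM (cl i) (cl i))).
    rewrite (cvg_unique _ (hc i) c1)// curve_energyE lerD2r.
    by apply: ler_wpM2l => //; rewrite invr_ge0 exprn_ge0// length_ge0.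
  apply: (@le_trans _ _ (\sum_(i < 3) c i)); first by apply: ler_sum => i _.
  have ce : (fun n => energy (G_ n)) @ U --> \sum_(i < 3) c i.
    rewrite sum_ord3; under eq_fun do rewrite /energy sum_ord3.
    by apply: cvgD; [apply: cvgD|]; exact: hc.
  apply/ler_addgt0Pr => e e0; apply: (cvgr_to_le ce); apply: UE.
  apply: filterS (near_harmonic e0) => n hn.
  by apply: (le_trans (Em n)); rewrite lerD2l.
Qed.

End existence.

Theorem corollary3p6 (R : realType) :
  exists Gmin : 'I_3 -> R -> 'rV[R]_2,
    (theta_network Gmin \/ degenerate_theta_network Gmin) /\
    forall G : 'I_3 -> R -> 'rV[R]_2, network G -> (Fbar Gmin <= Fbar G)%E.
Proof.
(* Minimising the real-valued [energy] over this class avoids infinite values; outside it [Fbar] is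
   +oo. *)
pose adm (G : 'I_3 -> R -> 'rV[R]_2) := network G /\ exists T0 T1, junction_tangents G T0 T1.
have [G1 [T0 [T1 [nG1 jG1]]]] := @junction_tangents_exist R.
pose S := [set energy G | G in adm].
have E0 (G : 'I_3 -> R -> 'rV[R]_2) : 0 <= energy G.
  by apply: sumr_ge0 => i _; exact: curve_energy_ge0.
have lbS : has_lbound S by exists 0 => _ [G _ <-].
have hS : has_inf S.
  by split => //; exists (energy G1), G1 => //; split => //; exists T0, T1.
have Gex n : exists GT : ('I_3 -> R -> 'rV[R]_2) * (('I_3 -> 'rV[R]_2) * ('I_3 -> 'rV[R]_2)),
    [/\ network GT.1, junction_tangents GT.1 GT.2.1 GT.2.2 &
        energy GT.1 <= inf S + n.+1%:R^-1].
  have n0 : 0 < n.+1%:R^-1 :> R by [].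
  have [_ [G [nG [t0 [t1 jG]]] <-] h] := inf_adherent n0 hS.
  by exists (G, (t0, t1)); split => //; exact: ltW.
have [GT hGT] := choice Gex.
have [|||G [t0 [t1 [nG jG EG]]]] :=
  @minimizing_limit R (fun n => (GT n).1) (fun n => (GT n).2.1) (fun n => (GT n).2.2) (inf S).
- by move=> n; have [] := hGT n.
- by move=> n; have [] := hGT n.
- by move=> n; have [] := hGT n.
have tdG := junction_tangents_characterization nG jG.
exists G; split; first exact: tdG.
move=> H nH.
have [tdH|ntd] := pselect (theta_network H \/ degenerate_theta_network H); last first.
  rewrite [leRHS]/Fbar; case: asboolP => [tH|_]; first by case: ntd; left.
  by case: asboolP => [dH|_]; [case: ntd; right|rewrite leey].
rewrite (Fbar_energy tdG) (Fbar_energy tdH) lee_fin; apply: (le_trans EG).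
apply: ge_inf; first exact: lbS.
exists H; last by [].
split; first exact: nH.
case: tdH; [exact: theta_junction_tangents|exact: degenerate_junction_tangents].
Qed.
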